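(* Let $f$ be a smooth real function of one variable, and let $x$ be a nondegenerate plane curve in $\mathbf{A}^2$ without affine inflection points, with general-affine curvature $k$ and sign $\epsilon=\pm1$. Let $'$ denote the derivative with respect to the general-affine length parameter of $x$, and let $f^{(j)}$ denote the $j$-th derivative of $f$. Put \[ G=4f^{(4)}(k)\,(k')^3+12f^{(3)}(k)\,k'k''+f^{(2)}(k)\,\bigl(4k'''-k'k^2+16\epsilon k'\bigr)-f^{(1)}(k)\,kk'+f(k)\,k'. \] Then $x$ is general-affine extremal with respect to the curvature functional $\int f(k)\,\omega_s$ if and only if \[ G''+\tfrac32\,G'k+\tfrac12\,Gk'+\tfrac12\,Gk^2+\epsilon G=0 . \]
   Context: All curves are smooth. A parametrized curve $x=x(t)$ in $\mathbf{A}^2$ is nondegenerate if $x'$ and $x''$ are linearly independent at every point. For a nondegenerate curve there exist a frame $e_1,e_2$ along $x$ (smooth, pointwise linearly independent vector fields along $x$, with $e_1$ a positive multiple of $dx/dt$), a $1$-form $\omega$ and a function $\ell$ such that $dx=\omega e_1$, $de_1=\omega e_2$, $de_2=-\ell\omega e_1$. These are unique up to $\tilde e_1=\lambda e_1$, $\tilde e_2=\lambda^2e_2$, $\tilde\omega=\lambda^{-1}\omega$, $\tilde\ell=\lambda^2\ell$ with a constant $\lambda>0$. A point where $\ell=0$ is an affine inflection point. Where $\ell\ne0$, the sign of the curve is $\epsilon=\mathrm{sign}(\ell)$, the general-affine length element is $\omega_s=\sqrt{\epsilon\ell}\,\omega$, a general-affine length parameter $s$ is one with $ds=\omega_s$,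 and the general-affine curvature $k$ is defined by $d\ell/\ell=k\,\omega_s$. Variations: a compactly supported deformation of $x$ is a smooth family of nondegenerate curves $x_\eta$, $\eta$ near $0$, with $x_0=x$, with $x_\eta(t)=x(t)$ for $t$ outside a compact set $C$ of parameters, and such that no $x_\eta$ has an affine inflection point. For such a family put $F(\eta)=\int_C f(k(\eta))\,\omega_s(\eta)$, where $k(\eta),\omega_s(\eta)$ are the curvature and length element of $x_\eta$. The curve $x$ is general-affine extremal with respect to the curvature functional if $\frac{dF}{d\eta}\big|_{\eta=0}=0$ for every compactly supported deformation of $x$. *)

(* Defs.v *)
From Stdlib Require Import Reals.
From Coquelicot Require Import Coquelicot.
Open Scope R_scope.

(* A parametrized plane curve is a total function [R -> R * R] of which only the
   values on an open, possibly unbounded, parameter interval (a, b) matter. *)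
Definition in_dom (a b : Rbar) (t : R) : Prop := Rbar_lt a t /\ Rbar_lt t b.

Definition smooth_on (a b : Rbar) (g : R -> R) : Prop :=
  forall (n : nat) (t : R), in_dom a b t -> ex_derive_n g n t.

Definition smooth_curve (a b : Rbar) (x : R -> R * R) : Prop :=
  smooth_on a b (fun t => fst (x t)) /\ smooth_on a b (fun t => snd (x t)).

Definition velocity (x : R -> R * R) (t : R) : R * R :=
  (Derive (fun u => fst (x u)) t, Derive (fun u => snd (x u)) t).

Definition lin_indep (u v : R * R) : Prop :=
  forall p q : R, plus (scal p u) (scal q v) = zero -> p = 0 /\ q = 0.

Definition nondegenerate (a b : Rbar) (x : R -> R * R) : Prop :=
  forall t, in_dom a b t -> lin_indep (velocity x t) (velocity (velocity x) t).

(* The 1-form is [omega t dt], represented by its coefficient. *)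
Record frame_data : Type := FrameData {
  e1 : R -> R * R;
  e2 : R -> R * R;
  omega : R -> R;
  ell : R -> R
}.

Definition is_affine_frame (a b : Rbar) (x : R -> R * R) (E : frame_data) : Prop :=
  smooth_curve a b (e1 E) /\ smooth_curve a b (e2 E) /\
  smooth_on a b (omega E) /\ smooth_on a b (ell E) /\
  forall t, in_dom a b t ->
    lin_indep (e1 E t) (e2 E t) /\
    (exists c, 0 < c /\ e1 E t = scal c (velocity x t)) /\
    velocity x t = scal (omega E t) (e1 E t) /\
    velocity (e1 E) t = scal (omega E t) (e2 E t) /\
    velocity (e2 E) t = scal (- ell E t * omega E t) (e1 E t).

Definition inflection_point (a b : Rbar) (x : R -> R * R) (t : R) : Prop :=
  exists E, is_affine_frame a b x E /\ ell E t = 0.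

Definition no_inflection (a b : Rbar) (x : R -> R * R) : Prop :=
  forall t, in_dom a b t -> ~ inflection_point a b x t.

(* The frame of a curve is unique up to (l e1, l^2 e2, l^-1 omega, l^2 ell) with
   a constant l > 0; the three functions below do not depend on this choice. *)
Definition ga_sign (E : frame_data) (t : R) : R := sign (ell E t).

(* omega_s = ga_length_element t dt *)
Definition ga_length_element (E : frame_data) (t : R) : R :=
  sqrt (ga_sign E t * ell E t) * omega E t.

(* d ell / ell = k omega_s, solved for k *)
Definition ga_curvature (E : frame_data) (t : R) : R :=
  Derive (ell E) t / ell E t / ga_length_element E t.

Definition ga_length_parameter (a b : Rbar) (E : frame_data) (s : R -> R) : Prop :=
  forall t, in_dom a b t -> is_derive s t (ga_length_element E t).

(* dg/ds at the point of parameter t, for functions g, s of t *)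
Definition deriv_wrt (s g : R -> R) (t : R) : R := Derive g t / Derive s t.

(* [X eta] is the curve x_eta, for |eta| < delta, and the compact set of
   parameters is C = [c, d]; [ex_diff_n _ n] for all n is joint smoothness in
   (eta, t).  Every compact subset of (a, b) lies in such a C; enlarging C only
   adds to the functional a constant independent of eta. *)
Definition compact_deformation (a b : Rbar) (x : R -> R * R)
    (X : R -> R -> R * R) (delta c d : R) : Prop :=
  0 < delta /\ in_dom a b c /\ in_dom a b d /\ c <= d /\
  (forall n eta t, Rabs eta < delta -> in_dom a b t ->
     ex_diff_n (fun u v => fst (X u v)) n eta t /\
     ex_diff_n (fun u v => snd (X u v)) n eta t) /\
  (forall eta, Rabs eta < delta ->
     nondegenerate a b (X eta) /\ no_inflection a b (X eta)) /\
  (forall t, in_dom a b t -> X 0 t = x t) /\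
  (forall eta t, Rabs eta < delta -> in_dom a b t -> ~ (c <= t <= d) ->
     X eta t = x t).

Definition curvature_functional (f : R -> R) (c d : R) (E : frame_data) : R :=
  RInt (fun t => f (ga_curvature E t) * ga_length_element E t) c d.

(* [E eta] is any frame of x_eta: its choice does not affect the integral. *)
Definition ga_extremal (a b : Rbar) (f : R -> R) (x : R -> R * R) : Prop :=
  forall (X : R -> R -> R * R) (delta c d : R) (E : R -> frame_data),
    compact_deformation a b x X delta c d ->
    (forall eta, Rabs eta < delta -> is_affine_frame a b (X eta) (E eta)) ->
    is_derive (fun eta => curvature_functional f c d (E eta)) 0 0.

(* Main.v *)
Require Import Defs.
From Stdlib Require Import Reals Lra Lia.
From Coquelicot Require Import Coquelicot.
Open Scope R_scope.

(** Fix a curve with Wronskian W = det(x', x'') and put p = W' / (3 W), T = x',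
n = x'' - p T, the prime being d/dt.  Since W' = det(x', x'''), there is a function q with
T' = p T + n and n' = 2 p n - q T.  Comparing with an affine frame gives T = omega e1,
n = omega^2 e2, p = omega' / omega and q = omega^2 ell ([frame_invariants]), so the length
density is sg = sqrt |q| and the curvature is k = (q' / q - 2 p) / sg: neither depends on the
frame, and both make sense, with smooth dependence on eta, for a whole family of curves.

For a family, let delta = d/d eta and delta x = mu T + nu n.  As delta commutes with d/dt,
applying it to the structure equations determines delta p and delta q
([connection_variation]).  With
  w = nu' + 2 p nu,   m = mu + w,   P = w' + p w + q nu
the result is
  delta p = (m' + p m - 2/3 P)',   delta q = (q m)' + q m' + (P'' - p P') / 3.
The function m acts as an infinitesimal reparametrization and contributes only
(f(k) sg m)' to the variation of the density f(k) sg ([density_variation]).  What remains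
involves the deformation only through P.  Write D = (1/sg) d/dt for the derivative by
general-affine length, e = q / sg^2 for the sign, and N = sg^2 nu.  Moving all derivatives
off P turns the remainder into - (e/12) sg G P up to a t-derivative, where G is the
expression of the theorem; and
  P = D D N - 3/2 k D N - (D k) N + 1/2 k^2 N + e N,
whose formal adjoint applied to G is exactly
  D D G + 3/2 k D G + 1/2 G D k + 1/2 k^2 G + e G
([momentum_by_parts]).  Hence the eta-derivative of the density is B' - (e/12) sg N L with
L the Euler-Lagrange expression and B a function that vanishes wherever the deformation does
([density_first_variation]).  Integrating over [c, d], where the deformation dies at the ends,
gives dF/d eta = - (1/12) times the integral of e sg N L ([first_variation]).

So L = 0 implies extremality.  Conversely, if L does not vanish at t0, deform x in the
direction e phi L e2, where phi is a bump function around t0 in an interval free of zeros of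
L: the integrand above becomes positive, which contradicts extremality.  That this is an
admissible deformation for small eta follows by compactness ([normal_deformation_compact]). *)

(** * Smooth functions of two variables and their partial derivatives *)

Inductive coord : Type := Eta | Time.

(** Families are functions of [(eta, t)], in this order. *)
Definition pd (i : coord) (F : R -> R -> R) (u v : R) : R :=
  match i with
  | Eta => Derive (fun z => F z v) u
  | Time => Derive (fun z => F u z) v
  end.

(** A relational form of partial differentiation: derivatives are then computed by syntax-directed
    rules, and [Derive] enters only through uniqueness. *)
Definition isd (U : R -> R -> Prop) (i : coord) (F F' : R -> R -> R) : Prop :=
  forall u v, U u v ->
  match i with
  | Eta => is_derive (fun z => F z v) u (F' u v)
  | Time => is_derive (fun z => F u z) v (F' u v)
  end.

Definition smooth2 (U : R -> R -> Prop) (F : R -> R -> R) : Prop :=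
  forall n u v, U u v -> ex_diff_n F n u v.

Definition open2 (U : R -> R -> Prop) : Prop :=
  forall u v, U u v -> locally_2d U u v.

Section Calculus.

Variable U : R -> R -> Prop.

Lemma isd_unique i F F1 F2 :
  isd U i F F1 -> isd U i F F2 -> forall u v, U u v -> F1 u v = F2 u v.
Proof.
  intros H1 H2 u v Huv; specialize (H1 u v Huv); specialize (H2 u v Huv).
  destruct i; apply is_derive_unique in H1; apply is_derive_unique in H2; congruence.
Qed.

Lemma pd_isd i F F' : isd U i F F' -> forall u v, U u v -> pd i F u v = F' u v.
Proof.
  intros H u v Huv; specialize (H u v Huv).
  destruct i; apply is_derive_unique in H; exact H.
Qed.

Lemma isd_eq i F F' G' :
  isd U i F F' -> (forall u v, U u v -> F' u v = G' u v) -> isd U i F G'.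
Proof. intros H E u v Huv; rewrite <- (E u v Huv); exact (H u v Huv). Qed.

Lemma isd_const i c : isd U i (fun _ _ => c) (fun _ _ => 0).
Proof. intros u v _; destruct i; apply (is_derive_const (K := R_AbsRing) (V := R_NormedModule)). Qed.

Lemma isd_plus i F F' G G' : isd U i F F' -> isd U i G G' ->
  isd U i (fun u v => F u v + G u v) (fun u v => F' u v + G' u v).
Proof.
  intros HF HG u v Huv; specialize (HF u v Huv); specialize (HG u v Huv).
  destruct i; apply (is_derive_plus (K := R_AbsRing) (V := R_NormedModule)); assumption.
Qed.

Lemma isd_opp i F F' : isd U i F F' ->
  isd U i (fun u v => - F u v) (fun u v => - F' u v).
Proof.
  intros HF u v Huv; specialize (HF u v Huv).
  destruct i; apply (is_derive_opp (K := R_AbsRing) (V := R_NormedModule)); assumption.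
Qed.

Lemma isd_minus i F F' G G' : isd U i F F' -> isd U i G G' ->
  isd U i (fun u v => F u v - G u v) (fun u v => F' u v - G' u v).
Proof. intros; apply isd_plus; [|apply isd_opp]; assumption. Qed.

Lemma isd_mult i F F' G G' : isd U i F F' -> isd U i G G' ->
  isd U i (fun u v => F u v * G u v) (fun u v => F' u v * G u v + F u v * G' u v).
Proof.
  intros HF HG u v Huv; specialize (HF u v Huv); specialize (HG u v Huv).
  destruct i.
  - exact (is_derive_mult (fun z => F z v) (fun z => G z v) u _ _ HF HG Rmult_comm).
  - exact (is_derive_mult (fun z => F u z) (fun z => G u z) v _ _ HF HG Rmult_comm).
Qed.

Lemma isd_comp i (g g' : R -> R) F F' :
  (forall u v, U u v -> is_derive g (F u v) (g' (F u v))) -> isd U i F F' ->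
  isd U i (fun u v => g (F u v)) (fun u v => g' (F u v) * F' u v).
Proof.
  intros Hg HF u v Huv; specialize (HF u v Huv); specialize (Hg u v Huv).
  rewrite Rmult_comm.
  destruct i.
  - apply (is_derive_comp g (fun z => F z v)); assumption.
  - apply (is_derive_comp g (fun z => F u z)); assumption.
Qed.

Lemma isd_inv i F F' : (forall u v, U u v -> F u v <> 0) -> isd U i F F' ->
  isd U i (fun u v => / F u v) (fun u v => - (F' u v * / F u v * / F u v)).
Proof.
  intros HF0 HF; eapply isd_eq.
  - apply (isd_comp i Rinv (fun z => - / z ^ 2)); [|exact HF].
    intros u v Huv; auto_derive; [exact (HF0 u v Huv)|]. field. exact (HF0 u v Huv).
  - intros u v Huv; cbn beta; field; exact (HF0 u v Huv).
Qed.

Lemma isd_div i F F' G G' : (forall u v, U u v -> G u v <> 0) ->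
  isd U i F F' -> isd U i G G' ->
  isd U i (fun u v => F u v / G u v)
    (fun u v => (F' u v * G u v - F u v * G' u v) / G u v ^ 2).
Proof.
  intros HG0 HF HG; eapply isd_eq.
  - apply isd_mult; [exact HF|apply isd_inv; [exact HG0|exact HG]].
  - intros u v Huv; cbn beta; field; exact (HG0 u v Huv).
Qed.

Hypothesis U_open : open2 U.

Lemma isd_ext i F G F' : (forall u v, U u v -> F u v = G u v) ->
  isd U i F F' -> isd U i G F'.
Proof.
  intros E HF u v Huv; specialize (HF u v Huv); pose proof (U_open u v Huv) as L.
  destruct i.
  - eapply is_derive_ext_loc; [|exact HF].
    apply locally_2d_1d_const_y in L; revert L; apply filter_imp; intros; auto.
  - eapply is_derive_ext_loc; [|exact HF].
    apply locally_2d_1d_const_x in L; revert L; apply filter_imp; intros; auto.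
Qed.

Lemma smooth2_isd i F : smooth2 U F -> isd U i F (pd i F).
Proof.
  intros H u v Huv; destruct (H 1%nat u v Huv) as (_ & He & Ht & _).
  destruct i; apply Derive_correct; assumption.
Qed.

Lemma smooth2_pd i F : smooth2 U F -> smooth2 U (pd i F).
Proof.
  intros H n u v Huv; destruct (H (S n) u v Huv) as (_ & _ & _ & He & Ht).
  destruct i; assumption.
Qed.

Lemma smooth2_cont F u v : smooth2 U F -> U u v -> continuity_2d_pt F u v.
Proof. intros H Huv; exact (proj1 (H 0%nat u v Huv)). Qed.

(** The classes of finite order in which closure properties are proved by induction; each operation
    loses one order when it is differentiated. *)
Definition diff_n (n : nat) (F : R -> R -> R) : Prop :=
  forall u v, U u v -> ex_diff_n F n u v.

Lemma diff_n_S n F : diff_n (S n) F -> diff_n n F.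
Proof. intros H u v Huv; eapply ex_diff_n_m; [|exact (H u v Huv)]; lia. Qed.

Lemma diff_n_ext n F G : (forall u v, U u v -> F u v = G u v) ->
  diff_n n F -> diff_n n G.
Proof.
  intros E H u v Huv; eapply ex_diff_n_ext_loc; [|exact (H u v Huv)].
  eapply locally_2d_impl; [|exact (U_open u v Huv)].
  apply locally_2d_forall; intros; auto.
Qed.

Lemma diff_n_pd n F i : diff_n (S n) F -> isd U i F (pd i F) /\ diff_n n (pd i F).
Proof.
  intros H; split.
  - intros u v Huv; destruct (H u v Huv) as (_ & He & Ht & _).
    destruct i; apply Derive_correct; assumption.
  - intros u v Huv; destruct (H u v Huv) as (_ & _ & _ & He & Ht).
    destruct i; assumption.
Qed.

(** The induction step shared by all closure properties: it suffices to exhibit both partial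
    derivatives and show that they lie in the preceding class. *)
Lemma diff_n_intro n F (F' : coord -> R -> R -> R) :
  diff_n 0 F -> (forall i, isd U i F (F' i)) -> (forall i, diff_n n (F' i)) ->
  diff_n (S n) F.
Proof.
  intros H0 HF HF'.
  assert (Hpd : forall i, diff_n n (pd i F)).
  { intro i; apply (diff_n_ext n (F' i)); [|apply HF'].
    intros u v Huv; symmetry; apply (pd_isd i F (F' i)); auto. }
  intros u v Huv; refine (conj (proj1 (H0 u v Huv)) (conj _ (conj _ (conj _ _)))).
  - eexists; exact (HF Eta u v Huv).
  - eexists; exact (HF Time u v Huv).
  - exact (Hpd Eta u v Huv).
  - exact (Hpd Time u v Huv).
Qed.

Lemma diff_n_const n c : diff_n n (fun _ _ => c).
Proof.
  revert c; induction n as [|n IH]; intros c.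
  - intros u v _; split; [apply continuity_2d_pt_const|exact I].
  - apply (diff_n_intro n _ (fun _ _ _ => 0)).
    + intros u v _; split; [apply continuity_2d_pt_const|exact I].
    + intro i; apply isd_const.
    + intro i; apply IH.
Qed.

Lemma diff_n_plus n F G : diff_n n F -> diff_n n G -> diff_n n (fun u v => F u v + G u v).
Proof.
  revert F G; induction n as [|n IH]; intros F G HF HG.
  - intros u v Huv; split; [|exact I].
    apply continuity_2d_pt_plus; [apply (HF u v Huv)|apply (HG u v Huv)].
  - apply (diff_n_intro n _ (fun i u v => pd i F u v + pd i G u v)).
    + intros u v Huv; split; [|exact I].
      apply continuity_2d_pt_plus; [apply (HF u v Huv)|apply (HG u v Huv)].
    + intro i; apply isd_plus; apply (diff_n_pd n); assumption.
    + intro i; apply IH; apply (diff_n_pd n); assumption.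
Qed.

Lemma diff_n_mult n F G : diff_n n F -> diff_n n G -> diff_n n (fun u v => F u v * G u v).
Proof.
  revert F G; induction n as [|n IH]; intros F G HF HG.
  - intros u v Huv; split; [|exact I].
    apply continuity_2d_pt_mult; [apply (HF u v Huv)|apply (HG u v Huv)].
  - apply (diff_n_intro n _ (fun i u v => pd i F u v * G u v + F u v * pd i G u v)).
    + intros u v Huv; split; [|exact I].
      apply continuity_2d_pt_mult; [apply (HF u v Huv)|apply (HG u v Huv)].
    + intro i; apply isd_mult; apply (diff_n_pd n); assumption.
    + intro i; apply diff_n_plus; apply IH;
        solve [apply (diff_n_pd n); assumption | apply diff_n_S; assumption].
Qed.

Lemma diff_n_comp n (g : R -> R) F :
  (forall m u v, U u v -> ex_derive_n g m (F u v)) -> diff_n n F ->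
  diff_n n (fun u v => g (F u v)).
Proof.
  revert g; induction n as [|n IH]; intros g Hg HF.
  all: assert (H0 : diff_n 0 (fun u v => g (F u v))) by
    (intros u v Huv; split; [|exact I];
     apply continuity_1d_2d_pt_comp; [|apply (HF u v Huv)];
     apply continuity_pt_filterlim, (ex_derive_continuous g), (Hg 1%nat u v Huv)).
  - exact H0.
  - apply (diff_n_intro n _ (fun i u v => Derive g (F u v) * pd i F u v)).
    + exact H0.
    + intro i; apply isd_comp; [|apply (diff_n_pd n); assumption].
      intros u v Huv; apply Derive_correct, (Hg 1%nat u v Huv).
    + intro i; apply diff_n_mult; [|apply (diff_n_pd n); assumption].
      apply IH; [|apply diff_n_S; assumption].
      intros m u v Huv; specialize (Hg (S m) u v Huv); destruct m as [|m]; [exact I|].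
      eapply ex_derive_ext; [|exact Hg].
      intro t; rewrite <- (Nat.add_1_r m); symmetry; exact (Derive_n_comp g m 1 t).
Qed.

Lemma smooth2_ext F G : (forall u v, U u v -> F u v = G u v) -> smooth2 U F -> smooth2 U G.
Proof. intros E H n; apply (diff_n_ext n F G E (H n)). Qed.

Lemma smooth2_const c : smooth2 U (fun _ _ => c).
Proof. intro n; apply diff_n_const. Qed.

Lemma smooth2_plus F G : smooth2 U F -> smooth2 U G -> smooth2 U (fun u v => F u v + G u v).
Proof. intros HF HG n; apply (diff_n_plus n F G (HF n) (HG n)). Qed.

Lemma smooth2_mult F G : smooth2 U F -> smooth2 U G -> smooth2 U (fun u v => F u v * G u v).
Proof. intros HF HG n; apply (diff_n_mult n F G (HF n) (HG n)). Qed.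

Lemma smooth2_opp F : smooth2 U F -> smooth2 U (fun u v => - F u v).
Proof.
  intros HF; apply (smooth2_ext (fun u v => (-1) * F u v)); [intros; ring|].
  apply smooth2_mult; [apply smooth2_const|exact HF].
Qed.

Lemma smooth2_minus F G : smooth2 U F -> smooth2 U G -> smooth2 U (fun u v => F u v - G u v).
Proof. intros; apply smooth2_plus; [|apply smooth2_opp]; assumption. Qed.

Lemma smooth2_comp (g : R -> R) F :
  (forall m u v, U u v -> ex_derive_n g m (F u v)) -> smooth2 U F ->
  smooth2 U (fun u v => g (F u v)).
Proof. intros Hg HF n; apply (diff_n_comp n g F Hg (HF n)). Qed.

Lemma smooth2_coord i : smooth2 U (fun u v => match i with Eta => u | Time => v end).
Proof.
  assert (H0 : diff_n 0 (fun u v => match i with Eta => u | Time => v end)).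
  { intros u v _; split; [|exact I].
    destruct i; [apply continuity_2d_pt_id1|apply continuity_2d_pt_id2]. }
  intros [|n]; [exact H0|].
  apply (diff_n_intro n _ (fun j _ _ =>
    match i, j with Eta, Eta | Time, Time => 1 | _, _ => 0 end)).
  - exact H0.
  - intros j u v _; destruct i, j;
      first [apply (is_derive_id (K := R_AbsRing))
            |apply (is_derive_const (K := R_AbsRing) (V := R_NormedModule))].
  - intro j; apply diff_n_const.
Qed.

Lemma diff_0_intro F : (forall u v, U u v -> continuity_2d_pt F u v) -> diff_n 0 F.
Proof. intros H u v Huv; split; [exact (H u v Huv)|exact I]. Qed.

Lemma smooth2_inv F : (forall u v, U u v -> F u v <> 0) -> smooth2 U F ->
  smooth2 U (fun u v => / F u v).
Proof.
  intros HF0 HF.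
  assert (H0 : diff_n 0 (fun u v => / F u v)).
  { intros u v Huv; split; [|exact I].
    apply continuity_2d_pt_inv; [apply smooth2_cont; assumption|exact (HF0 u v Huv)]. }
  intro n; induction n as [|n IH]; [exact H0|].
  apply (diff_n_intro n _ (fun i u v => - (pd i F u v * / F u v * / F u v))).
  - exact H0.
  - intro i; apply isd_inv; [exact HF0|apply smooth2_isd, HF].
  - intro i; apply (diff_n_ext n (fun u v => (-1) * (pd i F u v * / F u v * / F u v)));
      [intros; ring|].
    apply diff_n_mult; [apply diff_n_const|].
    apply diff_n_mult; [apply diff_n_mult; [exact (smooth2_pd i F HF n)|]|]; exact IH.
Qed.

Lemma smooth2_div F G : (forall u v, U u v -> G u v <> 0) ->
  smooth2 U F -> smooth2 U G -> smooth2 U (fun u v => F u v / G u v).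
Proof. intros; apply smooth2_mult; [|apply smooth2_inv]; assumption. Qed.

(** For functions such as powers and square roots, whose derivative is the function itself times a
    smooth factor, smoothness bootstraps from continuity. *)
Lemma smooth2_log_derivative F (L : coord -> R -> R -> R) :
  (forall u v, U u v -> continuity_2d_pt F u v) ->
  (forall i, isd U i F (fun u v => F u v * L i u v)) ->
  (forall i, smooth2 U (L i)) -> smooth2 U F.
Proof.
  intros HF HL Hs n; induction n as [|n IH]; [apply diff_0_intro, HF|].
  apply (diff_n_intro n _ (fun i u v => F u v * L i u v)).
  - apply diff_0_intro, HF.
  - exact HL.
  - intro i; apply diff_n_mult; [exact IH|exact (Hs i n)].
Qed.

(** Mixed partial derivatives commute.  This form transports a formula for d/d eta of a function to
    one for d/d eta of its t-derivative, which is how every variation below is propagated. *)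
Lemma isd_schwarz F A B C : smooth2 U F ->
  isd U Eta F A -> isd U Time F B -> isd U Time A C -> isd U Eta B C.
Proof.
  intros HF HA HB HC.
  assert (HE := smooth2_pd Eta F HF); assert (HT := smooth2_pd Time F HF).
  assert (HTA : isd U Time (pd Eta F) C).
  { apply (isd_ext Time A); [|exact HC].
    intros u v Huv; symmetry; apply (pd_isd Eta F A HA u v Huv). }
  apply (isd_ext Eta (pd Time F)); [intros u v Huv; apply (pd_isd Time F B HB u v Huv)|].
  apply (isd_eq Eta _ (pd Eta (pd Time F))); [apply smooth2_isd, HT|].
  intros u v Huv.
  rewrite <- (pd_isd Time (pd Eta F) C HTA u v Huv).
  apply Schwarz.
  - eapply locally_2d_impl; [|exact (U_open u v Huv)].
    apply locally_2d_forall; intros u' v' Huv'.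
    repeat split; eexists.
    + exact (smooth2_isd Eta F HF u' v' Huv').
    + exact (smooth2_isd Time F HF u' v' Huv').
    + exact (smooth2_isd Eta (pd Time F) HT u' v' Huv').
    + exact (smooth2_isd Time (pd Eta F) HE u' v' Huv').
  - exact (smooth2_cont _ u v (smooth2_pd Eta _ HT) Huv).
  - exact (smooth2_cont _ u v (smooth2_pd Time _ HE) Huv).
Qed.

End Calculus.

(** * Variation of the structure equations of a family of curves *)

Ltac isd_rule :=
  lazymatch goal with
  | |- isd _ _ (fun _ _ => ?c) _ => apply isd_const
  | |- isd ?U ?i (fun u v => @?A u v + @?B u v) _ => eapply (isd_plus U i A _ B _)
  | |- isd ?U ?i (fun u v => @?A u v - @?B u v) _ => eapply (isd_minus U i A _ B _)
  | |- isd ?U ?i (fun u v => @?A u v * @?B u v) _ => eapply (isd_mult U i A _ B _)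
  | |- isd ?U ?i (fun u v => @?A u v / @?B u v) _ => eapply (isd_div U i A _ B _)
  | |- isd ?U ?i (fun u v => - @?A u v) _ => eapply (isd_opp U i A _)
  end.

Ltac isd_auto := repeat first [eassumption | isd_rule]; cbn beta.

Ltac smooth_rule :=
  lazymatch goal with
  | |- smooth2 _ (pd _ _) => apply smooth2_pd
  | |- smooth2 _ (fun _ _ => ?c) => apply smooth2_const
  | |- smooth2 ?U (fun u v => @?A u v + @?B u v) => apply (smooth2_plus U ltac:(assumption) A B)
  | |- smooth2 ?U (fun u v => @?A u v - @?B u v) => apply (smooth2_minus U ltac:(assumption) A B)
  | |- smooth2 ?U (fun u v => @?A u v * @?B u v) => apply (smooth2_mult U ltac:(assumption) A B)
  | |- smooth2 ?U (fun u v => @?A u v / @?B u v) => apply (smooth2_div U ltac:(assumption) A B)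
  | |- smooth2 ?U (fun u v => - @?A u v) => apply (smooth2_opp U ltac:(assumption) A)
  | |- smooth2 _ (fun u v => pd ?i ?F u v) => apply (smooth2_pd _ i F)
  end.

Ltac smooth_auto := repeat first [assumption | smooth_rule]; cbn beta.

Section Variation.

Variable U : R -> R -> Prop.
Hypothesis U_open : open2 U.

(** One Cartesian component of the identity obtained by applying d/d eta to the structure equations
    [T' = p T + n] and [n' = 2 p n - q T].  Its two coefficients do not depend on the component, so
    independence of [T] and [n] makes them vanish separately.  The deformation is decomposed as
    [(m - w) T + nu n] with [w = nu' + 2 p nu] because then the [n]-coefficient of d/d eta of [T] is
    just [m]. *)
Lemma component_variation (x T n p q m w nu P a1 c1 dp dq : R -> R -> R) :
  smooth2 U x -> smooth2 U T -> smooth2 U n -> 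
  isd U Time x T ->
  isd U Time T (fun u v => p u v * T u v + n u v) ->
  isd U Time n (fun u v => 2 * p u v * n u v - q u v * T u v) ->
  isd U Time nu (fun u v => w u v - 2 * p u v * nu u v) ->
  isd U Time w (fun u v => P u v - p u v * w u v - q u v * nu u v) ->
  isd U Time m (pd Time m) -> isd U Time P (pd Time P) ->
  isd U Time (fun u v => pd Time m u v + p u v * m u v - P u v) a1 ->
  isd U Time (fun u v => a1 u v - q u v * m u v - dp u v) c1 ->
  isd U Eta x (fun u v => (m u v - w u v) * T u v + nu u v * n u v) ->
  isd U Eta p dp -> isd U Eta q dq ->
  forall u v, U u v ->
  (c1 u v - p u v * (a1 u v - q u v * m u v - dp u v)
     - q u v * (pd Time m u v + p u v * m u v) + dq u v) * T u v
  + (3 * a1 u v + pd Time P u v - 3 * dp u v) * n u v = 0.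
Proof.
  intros Sx ST Sn Hx HT Hn Hnu Hw Hm HP Ha Hc Ex Ep Eq.
  set (a := fun u v => pd Time m u v + p u v * m u v - P u v).
  set (c := fun u v => a1 u v - q u v * m u v - dp u v).
  fold a in Ha; fold c in Hc.
  assert (ET : isd U Eta T (fun u v => a u v * T u v + m u v * n u v)).
  { eapply (isd_schwarz U U_open x); [exact Sx|exact Ex|exact Hx|].
    eapply isd_eq; [isd_auto|]. intros u v _; unfold a; cbn beta. ring. }
  assert (En : isd U Eta n (fun u v => c u v * T u v + (2 * a u v + P u v) * n u v)).
  { apply (isd_ext U U_open Eta (fun u v => (p u v * T u v + n u v) - p u v * T u v));
      [intros; ring|].
    eapply isd_eq.
    - eapply isd_minus; [|isd_auto].
      eapply (isd_schwarz U U_open T); [exact ST|exact ET|exact HT|]. isd_auto.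
    - intros u v _; unfold a, c; cbn beta; ring. }
  assert (EnT : isd U Eta (fun u v => 2 * p u v * n u v - q u v * T u v)
     (fun u v => (c1 u v + p u v * c u v - q u v * (2 * a u v + P u v)) * T u v
       + (2 * a1 u v + pd Time P u v + c u v + 2 * p u v * (2 * a u v + P u v)) * n u v)).
  { eapply (isd_schwarz U U_open n); [exact Sn|exact En|exact Hn|].
    eapply isd_eq; [isd_auto|]. intros u v _; cbn beta. ring. }
  intros u v Huv.
  assert (E := isd_unique U Eta _ _ (fun u v => 2 * dp u v * n u v
     + 2 * p u v * (c u v * T u v + (2 * a u v + P u v) * n u v)
     - dq u v * T u v - q u v * (a u v * T u v + m u v * n u v)) EnT
     ltac:(eapply isd_eq; [isd_rule; isd_auto|intros; cbn beta; ring]) u v Huv).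
  cbn beta in E; unfold a, c in *; cbn beta in E.
  apply Rminus_diag_eq in E; rewrite <- E; ring.
Qed.

Lemma vectors_independent T1 T2 n1 n2 A B :
  T1 * n2 - T2 * n1 <> 0 -> A * T1 + B * n1 = 0 -> A * T2 + B * n2 = 0 -> A = 0 /\ B = 0.
Proof.
  intros H0 H1 H2; split; apply (Rmult_eq_reg_r (T1 * n2 - T2 * n1)); trivial.
  - replace (A * (T1 * n2 - T2 * n1)) with ((A * T1 + B * n1) * n2 - (A * T2 + B * n2) * n1) by ring.
    rewrite H1, H2; ring.
  - replace (B * (T1 * n2 - T2 * n1)) with ((A * T2 + B * n2) * T1 - (A * T1 + B * n1) * T2) by ring.
    rewrite H1, H2; ring.
Qed.

(** The [n]-coefficient in [component_variation] gives the variation of [p]; once this is known, the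
    [T]-coefficient gives that of [q]. *)
Lemma connection_variation (x1 x2 T1 T2 n1 n2 p q m w nu P : R -> R -> R) :
  smooth2 U x1 -> smooth2 U x2 -> smooth2 U T1 -> smooth2 U T2 ->
  smooth2 U n1 -> smooth2 U n2 -> smooth2 U p -> smooth2 U q ->
  smooth2 U m -> smooth2 U P ->
  (forall u v, U u v -> T1 u v * n2 u v - T2 u v * n1 u v <> 0) ->
  isd U Time x1 T1 -> isd U Time x2 T2 ->
  isd U Time T1 (fun u v => p u v * T1 u v + n1 u v) ->
  isd U Time T2 (fun u v => p u v * T2 u v + n2 u v) ->
  isd U Time n1 (fun u v => 2 * p u v * n1 u v - q u v * T1 u v) ->
  isd U Time n2 (fun u v => 2 * p u v * n2 u v - q u v * T2 u v) ->
  isd U Time nu (fun u v => w u v - 2 * p u v * nu u v) ->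
  isd U Time w (fun u v => P u v - p u v * w u v - q u v * nu u v) ->
  isd U Eta x1 (fun u v => (m u v - w u v) * T1 u v + nu u v * n1 u v) ->
  isd U Eta x2 (fun u v => (m u v - w u v) * T2 u v + nu u v * n2 u v) ->
  isd U Eta p (fun u v => pd Time (pd Time m) u v + pd Time p u v * m u v
    + p u v * pd Time m u v - 2 / 3 * pd Time P u v) /\
  isd U Eta q (fun u v => pd Time q u v * m u v + 2 * q u v * pd Time m u v
    + (pd Time (pd Time P) u v - p u v * pd Time P u v) / 3).
Proof.
  intros Sx1 Sx2 ST1 ST2 Sn1 Sn2 Sp Sq Sm SP Hdet Hx1 Hx2 HT1 HT2 Hn1 Hn2 Hnu Hw Ex1 Ex2.
  assert (Ep := smooth2_isd U Eta p Sp). assert (Eq := smooth2_isd U Eta q Sq).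
  assert (Tm := smooth2_isd U Time m Sm). assert (TP := smooth2_isd U Time P SP).
  assert (Tq := smooth2_isd U Time q Sq). assert (Tp := smooth2_isd U Time p Sp).
  assert (Tm1 := smooth2_isd U Time _ (smooth2_pd U Time m Sm)).
  assert (TP1 := smooth2_isd U Time _ (smooth2_pd U Time P SP)).
  set (a1 := fun u v => pd Time (pd Time m) u v + pd Time p u v * m u v
    + p u v * pd Time m u v - pd Time P u v).
  assert (Sa1 : smooth2 U a1) by (unfold a1; smooth_auto).
  assert (Ha1 : isd U Time (fun u v => pd Time m u v + p u v * m u v - P u v) a1).
  { eapply isd_eq; [isd_auto|]. intros; unfold a1; ring. }
  set (c := fun u v => a1 u v - q u v * m u v - pd Eta p u v).
  assert (Sc : smooth2 U c) by (unfold c; smooth_auto).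
  assert (Hc := smooth2_isd U Time c Sc).
  assert (main : forall u v, U u v ->
     pd Time c u v - p u v * c u v
     - q u v * (pd Time m u v + p u v * m u v) + pd Eta q u v = 0 /\
     3 * a1 u v + pd Time P u v - 3 * pd Eta p u v = 0).
  { intros u v Huv.
    apply (vectors_independent (T1 u v) (T2 u v) (n1 u v) (n2 u v)); [auto| |].
    - apply (component_variation x1 T1 n1 p q m w nu P a1 (pd Time c) (pd Eta p) (pd Eta q));
        assumption.
    - apply (component_variation x2 T2 n2 p q m w nu P a1 (pd Time c) (pd Eta p) (pd Eta q));
        assumption. }
  assert (dp : forall u v, U u v -> pd Eta p u v = a1 u v + pd Time P u v / 3).
  { intros u v Huv; destruct (main u v Huv) as [_ E]; lra. }
  split.
  - eapply isd_eq; [exact Ep|]. intros u v Huv; rewrite (dp u v Huv); unfold a1; lra.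
  - eapply isd_eq; [exact Eq|]. intros u v Huv.
    assert (Ec : pd Time c u v = - pd Time (pd Time P) u v / 3
                  - pd Time q u v * m u v - q u v * pd Time m u v).
    { apply (pd_isd U Time c (fun u v => - pd Time (pd Time P) u v / 3
                  - pd Time q u v * m u v - q u v * pd Time m u v)); [|exact Huv].
      apply (isd_ext U U_open Time (fun u v => - (1 / 3) * pd Time P u v - q u v * m u v)).
      - intros u' v' H; unfold c; rewrite (dp u' v' H); lra.
      - eapply isd_eq; [isd_auto|]. intros; cbn beta; lra. }
    destruct (main u v Huv) as [E _]; rewrite Ec in E.
    unfold c in E; rewrite (dp u v Huv) in E; lra.
Qed.

End Variation.

(** * Variation of the curvature density and integration by parts *)

(** The derivative by general-affine length when [sg] is the length density. *)
Definition arc_derivative (sg F : R -> R -> R) (u v : R) : R := pd Time F u v / sg u v.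

Definition momentum (f : R -> R) (e sg k : R -> R -> R) (u v : R) : R :=
  let D := arc_derivative sg in
  4 * Derive_n f 4 (k u v) * (D k u v) ^ 3
  + 12 * Derive_n f 3 (k u v) * D k u v * D (D k) u v
  + Derive_n f 2 (k u v) *
      (4 * D (D (D k)) u v - D k u v * (k u v) ^ 2 + 16 * e u v * D k u v)
  - Derive_n f 1 (k u v) * k u v * D k u v
  + f (k u v) * D k u v.

Definition euler_lagrange (f : R -> R) (e sg k : R -> R -> R) (u v : R) : R :=
  let D := arc_derivative sg in
  let G := momentum f e sg k in
  D (D G) u v + 3 / 2 * D G u v * k u v + 1 / 2 * G u v * D k u v
  + 1 / 2 * G u v * (k u v) ^ 2 + e u v * G u v.

Section Lagrangian.

Variable U : R -> R -> Prop.
Hypothesis U_open : open2 U.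
Variable f : R -> R.
Hypothesis f_smooth : forall n r, ex_derive_n f n r.

Lemma isd_Derive_n_comp i j F F' : isd U i F F' ->
  isd U i (fun u v => Derive_n f j (F u v)) (fun u v => Derive_n f (S j) (F u v) * F' u v).
Proof.
  intro HF; apply (isd_comp U i (Derive_n f j) (Derive_n f (S j))); [|exact HF].
  intros u v _; apply Derive_correct, (f_smooth (S j)).
Qed.

Lemma smooth2_Derive_n_comp j F : smooth2 U F -> smooth2 U (fun u v => Derive_n f j (F u v)).
Proof.
  intro SF; apply (smooth2_comp U U_open); [|exact SF].
  intros n u v _; destruct n as [|n]; [exact I|].
  apply (ex_derive_ext (Derive_n f (n + j))); [|apply (f_smooth (S (n + j)))].
  intro t; symmetry; apply Derive_n_comp.
Qed.

Lemma arc_derivative_smooth sg F : (forall u v, U u v -> sg u v <> 0) ->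
  smooth2 U sg -> smooth2 U F -> smooth2 U (arc_derivative sg F).
Proof. intros sg0 Ssg SF; unfold arc_derivative; smooth_auto. Qed.

Lemma momentum_smooth e sg k : (forall u v, U u v -> sg u v <> 0) ->
  smooth2 U e -> smooth2 U sg -> smooth2 U k -> smooth2 U (momentum f e sg k).
Proof.
  intros sg0 Se Ssg Sk.
  assert (SD := fun F => arc_derivative_smooth sg F sg0 Ssg).
  assert (S0 : smooth2 U (fun u v => f (k u v))) by exact (smooth2_Derive_n_comp 0 k Sk).
  assert (S1 := smooth2_Derive_n_comp 1 k Sk). assert (S2 := smooth2_Derive_n_comp 2 k Sk).
  assert (S3 := smooth2_Derive_n_comp 3 k Sk). assert (S4 := smooth2_Derive_n_comp 4 k Sk).
  assert (SK1 := SD _ Sk). assert (SK2 := SD _ SK1). assert (SK3 := SD _ SK2).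
  set (D := arc_derivative sg) in *.
  apply (smooth2_ext U U_open (fun u v =>
      4 * Derive_n f 4 (k u v) * (D k u v * (D k u v * D k u v))
      + 12 * Derive_n f 3 (k u v) * D k u v * D (D k) u v
      + Derive_n f 2 (k u v) *
      (4 * D (D (D k)) u v - D k u v * (k u v * k u v) + 16 * e u v * D k u v)
      - Derive_n f 1 (k u v) * k u v * D k u v + f (k u v) * D k u v)).
  - intros u v _; unfold momentum; cbv zeta; change (arc_derivative sg) with D; ring.
  - smooth_auto.
Qed.

Lemma euler_lagrange_smooth e sg k : (forall u v, U u v -> sg u v <> 0) ->
  smooth2 U e -> smooth2 U sg -> smooth2 U k -> smooth2 U (euler_lagrange f e sg k).
Proof.
  intros sg0 Se Ssg Sk.
  assert (SD := fun F => arc_derivative_smooth sg F sg0 Ssg).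
  assert (SG := momentum_smooth e sg k sg0 Se Ssg Sk).
  assert (SK1 := SD _ Sk). assert (SG1 := SD _ SG). assert (SG2 := SD _ SG1).
  set (D := arc_derivative sg) in *. set (G := momentum f e sg k) in *.
  apply (smooth2_ext U U_open (fun u v =>
     D (D G) u v + 3 / 2 * D G u v * k u v + 1 / 2 * G u v * D k u v
     + 1 / 2 * G u v * (k u v * k u v) + e u v * G u v)).
  - intros u v _; unfold euler_lagrange; cbv zeta; change (arc_derivative sg) with D.
    change (momentum f e sg k) with G; field.
  - smooth_auto.
Qed.

(** The terms with [m] are the effect of a reparametrization and add up to the t-derivative of
    [f (k) * sg * m].  The function [tau] is the rest of the logarithmic variation of [sg], and [dp]
    that of the variation of [p]. *)
Lemma density_variation (p q sg m tau dp : R -> R -> R) :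
  let k := fun u v => (pd Time q u v / q u v - 2 * p u v) / sg u v in
  smooth2 U p -> smooth2 U q -> smooth2 U m -> smooth2 U tau -> 
  (forall u v, U u v -> q u v <> 0) -> (forall u v, U u v -> sg u v <> 0) ->
  (forall i, isd U i sg (fun u v => sg u v * (pd i q u v / (2 * q u v)))) ->
  isd U Eta p (fun u v => pd Time (pd Time m) u v + pd Time p u v * m u v
    + p u v * pd Time m u v + dp u v) ->
  isd U Eta q (fun u v => pd Time q u v * m u v + 2 * q u v * pd Time m u v
    + 2 * q u v * tau u v) ->
  isd U Eta (fun u v => f (k u v) * sg u v)
    (fun u v => Derive f (k u v) * pd Time k u v * sg u v * m u v
       + f (k u v) * (pd Time sg u v * m u v + sg u v * pd Time m u v)
       + Derive f (k u v) * (2 * pd Time tau u v - 2 * dp u v - k u v * sg u v * tau u v)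
       + f (k u v) * sg u v * tau u v).
Proof.
  intros k Sp Sq Sm Stau q0 sg0 Hsg Ep Eq.
  assert (Tp := smooth2_isd U Time p Sp). assert (Tq := smooth2_isd U Time q Sq).
  assert (Tm := smooth2_isd U Time m Sm). assert (Ttau := smooth2_isd U Time tau Stau).
  assert (Sq1 := smooth2_pd U Time q Sq).
  assert (Tq1 := smooth2_isd U Time _ Sq1).
  assert (Tm1 := smooth2_isd U Time _ (smooth2_pd U Time m Sm)).
  assert (Tsg := Hsg Time); assert (Esg := Hsg Eta).
  assert (Eq1 : isd U Eta (pd Time q) (fun u v =>
     pd Time (pd Time q) u v * m u v + 3 * pd Time q u v * pd Time m u v
     + 2 * q u v * pd Time (pd Time m) u v
     + 2 * pd Time q u v * tau u v + 2 * q u v * pd Time tau u v)).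
  { eapply (isd_schwarz U U_open q); [exact Sq|exact Eq|exact Tq|].
    eapply isd_eq; [isd_auto|]. intros; cbn beta; ring. }
  assert (Eq' := pd_isd U Eta q _ Eq).
  assert (Tk : isd U Time k (fun u v =>
     ((pd Time (pd Time q) u v * q u v - pd Time q u v ^ 2) / q u v ^ 2
        - 2 * pd Time p u v) / sg u v - k u v * (pd Time q u v / (2 * q u v)))).
  { unfold k; eapply isd_eq; [isd_auto; assumption|].
    intros u v Huv; cbn beta; field; auto. }
  assert (Ek : isd U Eta k (fun u v => pd Time k u v * m u v
     + (2 * pd Time tau u v - 2 * dp u v) / sg u v - k u v * tau u v)).
  { unfold k at 1; eapply isd_eq; [isd_auto; assumption|].
    intros u v Huv; cbn beta; rewrite (pd_isd U Time k _ Tk u v Huv), (Eq' u v Huv).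
    unfold k; field; auto. }
  eapply isd_eq.
  - apply isd_mult; [|exact Esg].
    apply (isd_comp U Eta f (Derive f)); [|exact Ek].
    intros u v _; apply Derive_correct, (f_smooth 1).
  - intros u v Huv; cbn beta.
    rewrite (pd_isd U Time sg _ Tsg u v Huv), (Eq' u v Huv).
    field; auto.
Qed.

(** Two integrations by parts.  With [h = f - k f' - 2 f'' D k], the terms with [tau] and its
    derivative combine, up to a t-derivative, to [h sg tau], and moving two derivatives from [P] onto [h] produces the factor
    [momentum]; moving the two derivatives in [P] from [N] onto [momentum] produces
    [euler_lagrange].  The function [B] collects the boundary terms. *)
Lemma momentum_by_parts (sg k e N P tau : R -> R -> R) :
  let D := arc_derivative sg in
  smooth2 U k -> smooth2 U sg -> smooth2 U N -> smooth2 U P -> smooth2 U tau -> smooth2 U e ->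
  (forall u v, U u v -> sg u v <> 0) ->
  isd U Time e (fun _ _ => 0) -> (forall u v, U u v -> e u v * e u v = 1) ->
  (forall u v, U u v -> tau u v = e u v / 6 * (D (D P) u v + 1 / 2 * k u v * D P u v)) ->
  (forall u v, U u v -> P u v = D (D N) u v - 3 / 2 * k u v * D N u v - D k u v * N u v
     + 1 / 2 * k u v ^ 2 * N u v + e u v * N u v) ->
  exists B, smooth2 U B /\
    (forall u v, N u v = 0 -> D N u v = 0 -> P u v = 0 -> D P u v = 0 -> tau u v = 0 ->
       B u v = 0) /\
    isd U Time B
    (fun u v => Derive f (k u v) * (2 * pd Time tau u v + 4 / 3 * pd Time P u v
                                    - k u v * sg u v * tau u v)
       + f (k u v) * sg u v * tau u v
       + 1 / 12 * e u v * sg u v * N u v * euler_lagrange f e sg k u v).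
Proof.
  intros D Sk Ssg SN SP Stau Se sg0 Te e1 Htau HP.
  set (G := momentum f e sg k).
  set (h := fun u v => f (k u v) - k u v * Derive f (k u v)
                      - 2 * Derive_n f 2 (k u v) * D k u v).
  set (h1 := fun u v => - (k u v * Derive_n f 2 (k u v) * D k u v)
                       - 2 * Derive_n f 3 (k u v) * D k u v * D k u v
                       - 2 * Derive_n f 2 (k u v) * D (D k) u v).
  assert (SD : forall F, smooth2 U F -> smooth2 U (D F)).
  { intros F SF; apply arc_derivative_smooth; assumption. }
  assert (TD : forall F, smooth2 U F -> isd U Time F (fun u v => sg u v * D F u v)).
  { intros F SF; eapply isd_eq; [exact (smooth2_isd U Time F SF)|].
    intros u v Huv; unfold D, arc_derivative; field; auto. }
  assert (Sf : forall j, smooth2 U (fun u v => Derive_n f j (k u v))).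
  { intro j; apply smooth2_Derive_n_comp, Sk. }
  assert (Tf : forall j, isd U Time (fun u v => Derive_n f j (k u v))
             (fun u v => Derive_n f (S j) (k u v) * (sg u v * D k u v))).
  { intro j; apply isd_Derive_n_comp, TD, Sk. }
  assert (SG : smooth2 U G) by (apply momentum_smooth; assumption).
  set (F0 := fun u v => f (k u v)). set (F1 := fun u v => Derive f (k u v)).
  set (F2 := fun u v => Derive_n f 2 (k u v)). set (F3 := fun u v => Derive_n f 3 (k u v)).
  set (F4 := fun u v => Derive_n f 4 (k u v)).
  assert (T0 : isd U Time F0 (fun u v => F1 u v * (sg u v * D k u v))) by exact (Tf 0%nat).
  assert (T1 : isd U Time F1 (fun u v => F2 u v * (sg u v * D k u v))) by exact (Tf 1%nat).
  assert (T2 : isd U Time F2 (fun u v => F3 u v * (sg u v * D k u v))) by exact (Tf 2%nat).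
  assert (T3 : isd U Time F3 (fun u v => F4 u v * (sg u v * D k u v))) by exact (Tf 3%nat).
  assert (Tk := TD k Sk). assert (Tk1 := TD _ (SD k Sk)).
  assert (Tk2 := TD _ (SD _ (SD k Sk))).
  assert (Th : isd U Time h (fun u v => sg u v * h1 u v)).
  { change (isd U Time (fun u v => F0 u v - k u v * F1 u v - 2 * F2 u v * D k u v)
       (fun u v => sg u v * h1 u v)).
    eapply isd_eq; [isd_auto|].
    intros u v _; unfold h1, F0, F1, F2, F3, F4; cbn beta; ring. }
  assert (Th1 : isd U Time h1 (fun u v => sg u v * (1 / 2 * (D k u v * h u v + k u v * h1 u v)
       + 8 * e u v * F2 u v * D k u v - 1 / 2 * G u v))).
  { change (isd U Time (fun u v => - (k u v * F2 u v * D k u v)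
                       - 2 * F3 u v * D k u v * D k u v
                       - 2 * F2 u v * D (D k) u v)
       (fun u v => sg u v * (1 / 2 * (D k u v * h u v + k u v * h1 u v)
       + 8 * e u v * F2 u v * D k u v - 1 / 2 * G u v))).
    eapply isd_eq; [isd_auto|].
    intros u v _; unfold h, h1, G, momentum, F0, F1, F2, F3, F4; cbv zeta; change (arc_derivative sg) with D; cbn beta.
    change (Derive_n f 1 (k u v)) with (Derive f (k u v)). field. }
  assert (TP := TD P SP). assert (TP1 := TD _ (SD P SP)).
  assert (TN := TD N SN). assert (TN1 := TD _ (SD N SN)).
  assert (TG := TD G SG). assert (TG1 := TD _ (SD G SG)).
  assert (Ttau := smooth2_isd U Time tau Stau).
  assert (TP' := pd_isd U Time P _ TP).
  assert (S0 : smooth2 U F0) by exact (Sf 0%nat). assert (S1 : smooth2 U F1) by exact (Sf 1%nat).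
  assert (S2 : smooth2 U F2) by exact (Sf 2%nat). assert (S3 : smooth2 U F3) by exact (Sf 3%nat).
  assert (SDk := SD k Sk). assert (SDDk := SD _ SDk).
  assert (SDP := SD P SP). assert (SDN := SD N SN). assert (SDG := SD G SG).
  assert (Sh : smooth2 U h).
  { change (smooth2 U (fun u v => F0 u v - k u v * F1 u v - 2 * F2 u v * D k u v)); smooth_auto. }
  assert (Sh1 : smooth2 U h1).
  { change (smooth2 U (fun u v => - (k u v * F2 u v * D k u v)
                       - 2 * F3 u v * D k u v * D k u v
                       - 2 * F2 u v * D (D k) u v)); smooth_auto. }
  exists (fun u v => 4 / 3 * (F1 u v * P u v) + 2 * (F1 u v * tau u v)
       + 1 / 6 * (e u v * (h u v * D P u v - h1 u v * P u v
                           + 1 / 2 * (k u v * (h u v * P u v))))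
       - 1 / 12 * (e u v * (G u v * D N u v - D G u v * N u v
                           - 3 / 2 * (k u v * (G u v * N u v))))).
  refine (conj _ (conj _ _)).
  - smooth_auto.
  - intros u v EN EDN EP EDP Et; rewrite EN, EDN, EP, EDP, Et; ring.
  - eapply isd_eq; [isd_auto|].
    intros u v Huv; cbn beta.
    unfold euler_lagrange; cbv zeta; change (arc_derivative sg) with D; fold G.
    rewrite (TP' u v Huv).
    assert (E1 := e1 u v Huv). assert (E2 := Htau u v Huv). assert (E3 := HP u v Huv).
    cbn beta.
    change (Derive f (k u v)) with (F1 u v). change (f (k u v)) with (F0 u v).
    assert (Eh : h u v = F0 u v - k u v * F1 u v - 2 * F2 u v * D k u v) by reflexivity.
    (* The middle expression isolates the relations for tau, P and e ^ 2 = 1, so that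
       each half is an identity of polynomials. *)
    transitivity
      (F1 u v * (2 * pd Time tau u v + 4 / 3 * (sg u v * D P u v))
       + 4 / 3 * F2 u v * sg u v * D k u v * P u v * (1 - e u v * e u v)
       + 2 * F2 u v * sg u v * D k u v * tau u v
       + sg u v * h u v * (e u v / 6 * (D (D P) u v + 1 / 2 * k u v * D P u v))
       + 1 / 12 * e u v * sg u v * G u v * (P u v
          - (D (D N) u v - 3 / 2 * k u v * D N u v - D k u v * N u v
     + 1 / 2 * k u v ^ 2 * N u v + e u v * N u v))
       + 1 / 12 * e u v * sg u v * N u v *
  (D (D G) u v + 3 / 2 * D G u v * k u v + 1 / 2 * G u v * D k u v
   + 1 / 2 * G u v * k u v ^ 2 + e u v * G u v)).
    + field.
    + rewrite <- E2, <- E3, E1, Eh. field.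
Qed.

End Lagrangian.

(** * Local invariants of a family of curves *)

Definition wronskian (x1 x2 : R -> R -> R) (u v : R) : R :=
  pd Time x1 u v * pd Time (pd Time x2) u v - pd Time x2 u v * pd Time (pd Time x1) u v.

(** Along an affine frame the Wronskian is a constant multiple of omega^3, so this is omega' / omega. *)
Definition speed_log_derivative (x1 x2 : R -> R -> R) (u v : R) : R :=
  pd Time (wronskian x1 x2) u v / (3 * wronskian x1 x2 u v).

(** Along an affine frame this is omega^2 ell; see [frame_invariants]. *)
Definition scaled_affine_curvature (x1 x2 : R -> R -> R) (u v : R) : R :=
  (pd Time (pd Time x1) u v * pd Time (pd Time (pd Time x2)) u v
   - pd Time (pd Time x2) u v * pd Time (pd Time (pd Time x1)) u v) / wronskian x1 x2 u v
  + pd Time (speed_log_derivative x1 x2) u v - 2 * speed_log_derivative x1 x2 u v ^ 2.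

Definition length_density (x1 x2 : R -> R -> R) (u v : R) : R :=
  sqrt (Rabs (scaled_affine_curvature x1 x2 u v)).

Definition curvature (x1 x2 : R -> R -> R) (u v : R) : R :=
  (pd Time (scaled_affine_curvature x1 x2) u v / scaled_affine_curvature x1 x2 u v
   - 2 * speed_log_derivative x1 x2 u v) / length_density x1 x2 u v.

Definition curve_sign (x1 x2 : R -> R -> R) (u v : R) : R :=
  scaled_affine_curvature x1 x2 u v / length_density x1 x2 u v ^ 2.

Lemma is_derive_sqrt_Rabs z : z <> 0 ->
  is_derive (fun y => sqrt (Rabs y)) z (sqrt (Rabs z) / (2 * z)).
Proof.
  intro z0; assert (P := Rabs_pos_lt z z0).
  assert (S := sqrt_lt_R0 _ P).
  assert (E : sqrt (Rabs z) * sqrt (Rabs z) = sign z * z).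
  { rewrite sqrt_sqrt by lra.
    destruct (Rlt_or_le z 0) as [H|H].
    - rewrite Rabs_left, sign_eq_m1; lra.
    - rewrite Rabs_right, sign_eq_1; lra. }
  replace (sqrt (Rabs z) / (2 * z)) with (sign z * 1 * / (2 * sqrt (Rabs z))).
  - apply (is_derive_comp sqrt Rabs).
    + apply is_derive_Reals, derivable_pt_lim_sqrt, P.
    + apply (is_derive_Rabs (fun y => y)); [apply (is_derive_id (K := R_AbsRing))|exact z0].
  - assert (Z : sign z = sqrt (Rabs z) * sqrt (Rabs z) / z) by (rewrite E; field; exact z0).
    rewrite Z; field; split; lra.
Qed.

Section Family.

Variable U : R -> R -> Prop.
Hypothesis U_open : open2 U.
Variables x1 x2 : R -> R -> R.
Hypothesis x1_smooth : smooth2 U x1.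
Hypothesis x2_smooth : smooth2 U x2.

Let W := wronskian x1 x2.
Hypothesis W_neq0 : forall u v, U u v -> W u v <> 0.

Let p := speed_log_derivative x1 x2.
Let q := scaled_affine_curvature x1 x2.
Let sg := length_density x1 x2.
Let k := curvature x1 x2.
Let e := curve_sign x1 x2.
Let T1 := pd Time x1.
Let T2 := pd Time x2.
Let n1 := fun u v => pd Time T1 u v - p u v * T1 u v.
Let n2 := fun u v => pd Time T2 u v - p u v * T2 u v.

Lemma wronskian_smooth : smooth2 U W.
Proof. unfold W, wronskian; smooth_auto. Qed.

Lemma speed_log_derivative_smooth : smooth2 U p.
Proof.
  assert (SW := wronskian_smooth).
  unfold p, speed_log_derivative; fold W; smooth_auto.
  intros u v Huv; specialize (W_neq0 u v Huv); lra.
Qed.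

Lemma scaled_affine_curvature_smooth : smooth2 U q.
Proof.
  assert (SW := wronskian_smooth). assert (Sp := speed_log_derivative_smooth).
  apply (smooth2_ext U U_open (fun u v => (pd Time (pd Time x1) u v * pd Time (pd Time (pd Time x2)) u v
   - pd Time (pd Time x2) u v * pd Time (pd Time (pd Time x1)) u v) / W u v
    + pd Time p u v - 2 * (p u v * p u v))).
  - intros; unfold q, scaled_affine_curvature; fold W; fold p; ring.
  - smooth_auto.
Qed.

Lemma log_derivative_wronskian : forall u v, U u v -> 
  pd Time W u v = 3 * p u v * W u v.
Proof.
  intros u v Huv; unfold p, speed_log_derivative; fold W; field; auto.
Qed.

Lemma wronskian_derivative : forall u v, U u v ->
  pd Time W u v = T1 u v * pd Time (pd Time T2) u v - T2 u v * pd Time (pd Time T1) u v.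
Proof.
  intros u v Huv.
  assert (ST1 : smooth2 U T1) by (apply smooth2_pd; assumption).
  assert (ST2 : smooth2 U T2) by (apply smooth2_pd; assumption).
  assert (H1 := smooth2_isd U Time T1 ST1). assert (H2 := smooth2_isd U Time T2 ST2).
  assert (H3 := smooth2_isd U Time _ (smooth2_pd U Time T1 ST1)).
  assert (H4 := smooth2_isd U Time _ (smooth2_pd U Time T2 ST2)).
  apply (pd_isd U Time W (fun u v =>
     T1 u v * pd Time (pd Time T2) u v - T2 u v * pd Time (pd Time T1) u v)); [|exact Huv].
  unfold W, wronskian; fold T1 T2.
  eapply isd_eq; [isd_auto|]. intros; cbn beta; ring.
Qed.

(** The tangent [T] and [n = T' - p T] satisfy linear structure equations: the choice of [p] makes the
    [n]-coefficient of [n'] equal to [2 p], because W' = 3 p W, and [q] is then the remaining coefficient. *)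
Lemma moving_frame :
  isd U Time T1 (fun u v => p u v * T1 u v + n1 u v) /\
  isd U Time T2 (fun u v => p u v * T2 u v + n2 u v) /\
  isd U Time n1 (fun u v => 2 * p u v * n1 u v - q u v * T1 u v) /\
  isd U Time n2 (fun u v => 2 * p u v * n2 u v - q u v * T2 u v) /\
  (forall u v, U u v -> T1 u v * n2 u v - T2 u v * n1 u v = W u v).
Proof.
  assert (ST1 : smooth2 U T1) by (apply smooth2_pd; assumption).
  assert (ST2 : smooth2 U T2) by (apply smooth2_pd; assumption).
  assert (H1 := smooth2_isd U Time T1 ST1). assert (H2 := smooth2_isd U Time T2 ST2).
  assert (H3 := smooth2_isd U Time _ (smooth2_pd U Time T1 ST1)).
  assert (H4 := smooth2_isd U Time _ (smooth2_pd U Time T2 ST2)).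
  assert (Hp := smooth2_isd U Time p speed_log_derivative_smooth).
  assert (E : forall u v, U u v -> 3 * p u v * W u v =
     T1 u v * pd Time (pd Time T2) u v - T2 u v * pd Time (pd Time T1) u v).
  { intros u v Huv; rewrite <- wronskian_derivative by exact Huv.
    symmetry; apply log_derivative_wronskian, Huv. }
  assert (EW : forall u v, W u v = T1 u v * pd Time T2 u v - T2 u v * pd Time T1 u v)
    by reflexivity.
  assert (Eq : forall u v, q u v = (pd Time T1 u v * pd Time (pd Time T2) u v
   - pd Time T2 u v * pd Time (pd Time T1) u v) / W u v + pd Time p u v - 2 * p u v ^ 2)
    by reflexivity.
  refine (conj _ (conj _ (conj _ (conj _ _)))).
  - eapply isd_eq; [exact H1|]. intros; unfold n1; ring.
  - eapply isd_eq; [exact H2|]. intros; unfold n2; ring.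
  - unfold n1; eapply isd_eq; [isd_auto|]. intros u v Huv; cbn beta; rewrite Eq.
    specialize (E u v Huv). specialize (EW u v). assert (W0 := W_neq0 u v Huv).
    apply (Rmult_eq_reg_r (W u v)); [|exact W0].
    apply Rminus_diag_uniq.
    transitivity ((3 * p u v * W u v) * pd Time T1 u v * (-1)
       + pd Time (pd Time T1) u v * W u v
       + (pd Time T1 u v * pd Time (pd Time T2) u v
   - pd Time T2 u v * pd Time (pd Time T1) u v) * T1 u v); [field; exact W0|].
    rewrite E, EW; ring.
  - unfold n2; eapply isd_eq; [isd_auto|]. intros u v Huv; cbn beta; rewrite Eq.
    specialize (E u v Huv). specialize (EW u v). assert (W0 := W_neq0 u v Huv).
    apply (Rmult_eq_reg_r (W u v)); [|exact W0].
    apply Rminus_diag_uniq.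
    transitivity ((3 * p u v * W u v) * pd Time T2 u v * (-1)
       + pd Time (pd Time T2) u v * W u v
       + (pd Time T1 u v * pd Time (pd Time T2) u v
   - pd Time T2 u v * pd Time (pd Time T1) u v) * T2 u v); [field; exact W0|].
    rewrite E, EW; ring.
  - intros u v Huv; rewrite EW; unfold n1, n2; ring.
Qed.

Hypothesis q_neq0 : forall u v, U u v -> q u v <> 0.

Lemma length_density_pos u v : U u v -> 0 < sg u v.
Proof. intro Huv; apply sqrt_lt_R0, Rabs_pos_lt, q_neq0, Huv. Qed.

Lemma length_density_neq0 u v : U u v -> sg u v <> 0.
Proof. intro Huv; apply Rgt_not_eq, length_density_pos, Huv. Qed.

(** The sign of [q] is eliminated by squaring; this is what makes the square of [curve_sign] equal to 1. *)
Lemma length_density_pow4 u v : (sg u v ^ 2) ^ 2 = q u v ^ 2.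
Proof.
  unfold sg, length_density; fold q.
  rewrite pow2_sqrt by apply Rabs_pos; apply pow2_abs.
Qed.

Lemma length_density_isd i :
  isd U i sg (fun u v => sg u v * (pd i q u v / (2 * q u v))).
Proof.
  eapply isd_eq.
  - apply (isd_comp U i (fun y => sqrt (Rabs y)) (fun z => sqrt (Rabs z) / (2 * z)) q).
    + intros u v Huv; apply is_derive_sqrt_Rabs, q_neq0, Huv.
    + apply smooth2_isd, scaled_affine_curvature_smooth.
  - intros u v Huv; unfold sg, length_density; fold q; field; apply q_neq0, Huv.
Qed.

Lemma length_density_smooth : smooth2 U sg.
Proof.
  assert (Sq := scaled_affine_curvature_smooth).
  apply (smooth2_log_derivative U U_open sg (fun i u v => pd i q u v / (2 * q u v))).
  - intros u v Huv; apply (continuity_1d_2d_pt_comp (fun y => sqrt (Rabs y)) q).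
    + apply continuity_pt_filterlim, (ex_derive_continuous (fun y => sqrt (Rabs y))).
      eexists; apply is_derive_sqrt_Rabs, q_neq0, Huv.
    + apply (smooth2_cont U); assumption.
  - apply length_density_isd.
  - intro i; smooth_auto. intros u v Huv; specialize (q_neq0 u v Huv); lra.
Qed.

Lemma curvature_smooth : smooth2 U k.
Proof.
  assert (Sq := scaled_affine_curvature_smooth). assert (Sp := speed_log_derivative_smooth).
  assert (Ssg := length_density_smooth). assert (H := length_density_neq0).
  unfold k, curvature; fold p q sg; smooth_auto.
Qed.

Lemma curve_sign_smooth : smooth2 U e.
Proof.
  assert (Sq := scaled_affine_curvature_smooth). assert (Ssg := length_density_smooth).
  assert (H := length_density_neq0).
  apply (smooth2_ext U U_open (fun u v => q u v / (sg u v * sg u v))).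
  - intros u v _; unfold e, curve_sign; fold q sg; f_equal; ring.
  - smooth_auto. intros u v Huv; apply Rmult_integral_contrapositive; auto.
Qed.

Lemma curve_sign_square u v : U u v -> e u v * e u v = 1.
Proof.
  intro Huv; unfold e, curve_sign; fold q sg.
  transitivity (q u v ^ 2 / (sg u v ^ 2) ^ 2).
  - field; apply length_density_neq0, Huv.
  - rewrite length_density_pow4; field; apply q_neq0, Huv.
Qed.

Lemma curve_sign_isd : isd U Time e (fun _ _ => 0).
Proof.
  assert (Tq := smooth2_isd U Time q scaled_affine_curvature_smooth).
  assert (Tsg := length_density_isd Time).
  assert (H := length_density_neq0).
  apply (isd_ext U U_open Time (fun u v => q u v / (sg u v * sg u v))).
  - intros u v _; unfold e, curve_sign; fold q sg; f_equal; ring.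
  - eapply isd_eq; [isd_auto|].
    + intros u v Huv; apply Rmult_integral_contrapositive; auto.
    + intros u v Huv; cbn beta; field; auto.
Qed.

End Family.

(** * First variation of the density *)

(** Unlike vanishing at a point, this passes to t-derivatives. *)
Definition vanishes_near (F : R -> R -> R) (u v : R) : Prop :=
  locally v (fun v' => F u v' = 0).

Lemma vanishes_near_pd F u v : vanishes_near F u v -> vanishes_near (pd Time F) u v.
Proof.
  unfold vanishes_near; intro H; apply locally_locally in H.
  apply (filter_imp (fun v' => locally v' (fun y => F u y = 0))); [intros v' L|exact H].
  transitivity (Derive (fun _ => 0) v'); [exact (Derive_ext_loc _ _ _ L)|apply Derive_const].
Qed.

(** The coefficient [nu] of the deformation along [n]: the pairing of the deformation with the tangent,
    since det(T, n) is the Wronskian. *)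
Definition normal_component (x1 x2 : R -> R -> R) (u v : R) : R :=
  (pd Time x1 u v * pd Eta x2 u v - pd Time x2 u v * pd Eta x1 u v) / wronskian x1 x2 u v.

Section FirstVariation.

Variable U : R -> R -> Prop.
Hypothesis U_open : open2 U.
Variables x1 x2 : R -> R -> R.
Hypothesis x1_smooth : smooth2 U x1.
Hypothesis x2_smooth : smooth2 U x2.
Hypothesis W_neq0 : forall u v, U u v -> wronskian x1 x2 u v <> 0.
Hypothesis q_neq0 : forall u v, U u v -> scaled_affine_curvature x1 x2 u v <> 0.
Variable f : R -> R.
Hypothesis f_smooth : forall n r, ex_derive_n f n r.

Lemma normal_component_smooth : smooth2 U (normal_component x1 x2).
Proof.
  assert (SW : smooth2 U (wronskian x1 x2)) by (apply wronskian_smooth; assumption).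
  unfold normal_component; smooth_auto.
Qed.

(** Combines the three preceding computations.  The boundary terms are linear in the
    deformation and its t-derivatives, hence the vanishing statement. *)
Lemma density_first_variation :
  exists B, smooth2 U B /\
    (forall u v, U u v -> vanishes_near (pd Eta x1) u v -> vanishes_near (pd Eta x2) u v ->
       B u v = 0) /\
    isd U Eta (fun u v => f (curvature x1 x2 u v) * length_density x1 x2 u v)
      (fun u v => pd Time B u v
         - 1 / 12 * curve_sign x1 x2 u v * length_density x1 x2 u v
           * (length_density x1 x2 u v ^ 2 * normal_component x1 x2 u v)
           * euler_lagrange f (curve_sign x1 x2) (length_density x1 x2) (curvature x1 x2) u v).
Proof.
  set (W := wronskian x1 x2). set (p := speed_log_derivative x1 x2).
  set (q := scaled_affine_curvature x1 x2). set (sg := length_density x1 x2).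
  set (k := curvature x1 x2). set (e := curve_sign x1 x2).
  set (T1 := pd Time x1). set (T2 := pd Time x2).
  set (n1 := fun u v => pd Time T1 u v - p u v * T1 u v).
  set (n2 := fun u v => pd Time T2 u v - p u v * T2 u v).
  assert (SW : smooth2 U W) by (apply wronskian_smooth; assumption).
  assert (Sp : smooth2 U p) by (apply speed_log_derivative_smooth; assumption).
  assert (Sq : smooth2 U q) by (apply scaled_affine_curvature_smooth; assumption).
  assert (Ssg : smooth2 U sg) by (apply length_density_smooth; assumption).
  assert (Sk : smooth2 U k) by (apply curvature_smooth; assumption).
  assert (Se : smooth2 U e) by (apply curve_sign_smooth; assumption).
  assert (ST1 : smooth2 U T1) by (apply smooth2_pd; assumption).
  assert (ST2 : smooth2 U T2) by (apply smooth2_pd; assumption).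
  assert (Sn1 : smooth2 U n1) by (unfold n1; smooth_auto).
  assert (Sn2 : smooth2 U n2) by (unfold n2; smooth_auto).
  assert (sg0 : forall u v, U u v -> sg u v <> 0)
    by (intros; apply (length_density_neq0 U); assumption).
  assert (Tsg := length_density_isd U U_open x1 x2 x1_smooth x2_smooth W_neq0 q_neq0 Time).
  assert (Te := curve_sign_isd U U_open x1 x2 x1_smooth x2_smooth W_neq0 q_neq0).
  assert (Isg := length_density_isd U U_open x1 x2 x1_smooth x2_smooth W_neq0 q_neq0).
  destruct (moving_frame U U_open x1 x2 x1_smooth x2_smooth W_neq0)
    as (HT1 & HT2 & Hn1 & Hn2 & Hdet0).
  assert (Hdet : forall u v, U u v -> T1 u v * n2 u v - T2 u v * n1 u v = W u v) by exact Hdet0.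
  clear Hdet0.
  fold W p q T1 T2 sg in HT1, HT2, Hn1, Hn2, Tsg, Isg, q_neq0, W_neq0.
  fold e in Te. fold n1 n2 in HT1, HT2, Hn1, Hn2.
  change (fun u v => pd Time T1 u v - p u v * T1 u v) with n1 in Hn1.
  change (fun u v => pd Time T2 u v - p u v * T2 u v) with n2 in Hn2.
  set (Y1 := pd Eta x1). set (Y2 := pd Eta x2).
  assert (SY1 : smooth2 U Y1) by (apply smooth2_pd; assumption).
  assert (SY2 : smooth2 U Y2) by (apply smooth2_pd; assumption).
  set (nu := normal_component x1 x2).
  assert (Enu : forall u v, nu u v = (T1 u v * Y2 u v - T2 u v * Y1 u v) / W u v) by reflexivity.
  assert (Snu : smooth2 U nu) by exact normal_component_smooth.
  set (w := fun u v => pd Time nu u v + 2 * p u v * nu u v).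
  assert (Sw : smooth2 U w) by (unfold w; smooth_auto).
  set (m := fun u v => (Y1 u v * n2 u v - Y2 u v * n1 u v) / W u v + w u v).
  assert (Sm : smooth2 U m) by (unfold m; smooth_auto).
  set (P := fun u v => pd Time w u v + p u v * w u v + q u v * nu u v).
  assert (SP : smooth2 U P) by (unfold P; smooth_auto).
  assert (q6 : forall u v, U u v -> 6 * q u v <> 0)
    by (intros u v Huv; specialize (q_neq0 u v Huv); lra).
  set (tau := fun u v => (pd Time (pd Time P) u v - p u v * pd Time P u v) / (6 * q u v)).
  assert (Stau : smooth2 U tau) by (unfold tau; smooth_auto).
  set (N := fun u v => sg u v * sg u v * nu u v).
  assert (SN : smooth2 U N) by (unfold N; smooth_auto).
  assert (Tnu : isd U Time nu (fun u v => w u v - 2 * p u v * nu u v)).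
  { eapply isd_eq; [exact (smooth2_isd U Time nu Snu)|]. intros; unfold w; ring. }
  assert (Tw : isd U Time w (fun u v => P u v - p u v * w u v - q u v * nu u v)).
  { eapply isd_eq; [exact (smooth2_isd U Time w Sw)|]. intros; unfold P; ring. }
  destruct (connection_variation U U_open x1 x2 T1 T2 n1 n2 p q m w nu P) as [Ep Eq];
    try assumption.
  { intros u v Huv; rewrite (Hdet u v Huv); auto. }
  { apply smooth2_isd; assumption. }
  { apply smooth2_isd; assumption. }
  { eapply isd_eq; [exact (smooth2_isd U Eta x1 x1_smooth)|].
    intros u v Huv; change (pd Eta x1 u v) with (Y1 u v); unfold m; rewrite Enu.
    rewrite <- (Hdet u v Huv); field; rewrite (Hdet u v Huv); auto. }
  { eapply isd_eq; [exact (smooth2_isd U Eta x2 x2_smooth)|].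
    intros u v Huv; change (pd Eta x2 u v) with (Y2 u v); unfold m; rewrite Enu.
    rewrite <- (Hdet u v Huv); field; rewrite (Hdet u v Huv); auto. }
  assert (Dens := density_variation U U_open f f_smooth p q sg m tau
    (fun u v => - (2 / 3) * pd Time P u v) Sp Sq Sm Stau q_neq0 sg0 Isg
    ltac:(eapply isd_eq; [exact Ep|intros; cbn beta; ring])
    ltac:(eapply isd_eq; [exact Eq|intros; unfold tau; cbn beta; field; auto])).
  change (fun u v => (pd Time q u v / q u v - 2 * p u v) / sg u v) with k in Dens.
  assert (TP := smooth2_isd U Time P SP).
  assert (TP1 := smooth2_isd U Time _ (smooth2_pd U Time P SP)).
  assert (Ek : forall u v, k u v = (pd Time q u v / q u v - 2 * p u v) / sg u v) by reflexivity.
  assert (Tsg' := pd_isd U Time sg _ Tsg).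
  assert (Htau : forall u v, U u v -> tau u v = e u v / 6
     * (arc_derivative sg (arc_derivative sg P) u v + 1 / 2 * k u v * arc_derivative sg P u v)).
  { intros u v Huv.
    assert (E : isd U Time (arc_derivative sg P) (fun u v =>
      (pd Time (pd Time P) u v - pd Time P u v * (pd Time q u v / (2 * q u v))) / sg u v)).
    { unfold arc_derivative; eapply isd_eq; [isd_auto; assumption|].
      intros; cbn beta; field; auto. }
    assert (E' := pd_isd U Time _ _ E u v Huv).
    assert (H4 := length_density_pow4 x1 x2 u v); fold sg q in H4.
    unfold arc_derivative at 1; rewrite E'.
    unfold arc_derivative; rewrite Ek.
    change (e u v) with (q u v / sg u v ^ 2). unfold tau.
    transitivity (q u v * (pd Time (pd Time P) u v - p u v * pd Time P u v)
                  / (6 * (sg u v ^ 2) ^ 2)); [rewrite H4|]; field; auto. }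
  assert (HP : forall u v, U u v -> P u v
     = arc_derivative sg (arc_derivative sg N) u v - 3 / 2 * k u v * arc_derivative sg N u v
       - arc_derivative sg k u v * N u v + 1 / 2 * k u v ^ 2 * N u v + e u v * N u v).
  { intros u v Huv.
    assert (TN : isd U Time N (fun u v => sg u v * (sg u v * w u v + k u v * N u v))).
    { unfold N; eapply isd_eq; [isd_auto|].
      intros; cbn beta; rewrite Ek; field; auto. }
    assert (DN : forall u v, U u v -> arc_derivative sg N u v = sg u v * w u v + k u v * N u v).
    { intros u' v' H; unfold arc_derivative; rewrite (pd_isd U Time N _ TN u' v' H); field; auto. }
    assert (Tk : isd U Time k (fun u v => sg u v * arc_derivative sg k u v)).
    { eapply isd_eq; [exact (smooth2_isd U Time k Sk)|].
      intros; unfold arc_derivative; field; auto. }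
    assert (TDN : isd U Time (arc_derivative sg N) (fun u v =>
       sg u v * (P u v - q u v * nu u v + 3 / 2 * k u v * sg u v * w u v
         + arc_derivative sg k u v * N u v + k u v ^ 2 * N u v))).
    { apply (isd_ext U U_open Time (fun u v => sg u v * w u v + k u v * N u v)).
      - intros; symmetry; auto.
      - eapply isd_eq; [isd_auto|].
        intros u' v' H; cbn beta.
        replace (pd Time q u' v' / (2 * q u' v')) with ((k u' v' * sg u' v' + 2 * p u' v') / 2)
          by (rewrite Ek; field; auto).
        field; auto. }
    unfold arc_derivative at 1; rewrite (pd_isd U Time _ _ TDN u v Huv), (DN u v Huv).
    change (e u v) with (q u v / sg u v ^ 2). unfold N; field; auto. }
  destruct (momentum_by_parts U U_open f f_smooth sg k e N P tau
    Sk Ssg SN SP Stau Se sg0 Te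
    (curve_sign_square U x1 x2 q_neq0) Htau HP) as (B1 & SB1 & ZB1 & TB1).
  set (B0 := fun u v => f (k u v) * (sg u v * m u v)).
  assert (TB0 : isd U Time B0 (fun u v => Derive f (k u v) * pd Time k u v * sg u v * m u v
       + f (k u v) * (pd Time sg u v * m u v + sg u v * pd Time m u v))).
  { assert (Tm := smooth2_isd U Time m Sm). assert (Tsg1 := smooth2_isd U Time sg Ssg).
    assert (Tfk : isd U Time (fun u v => f (k u v)) (fun u v => Derive f (k u v) * pd Time k u v))
      by exact (isd_Derive_n_comp U f f_smooth Time 0 k _ (smooth2_isd U Time k Sk)).
    clear Tsg.
    unfold B0; eapply isd_eq; [isd_auto|]. intros; cbn beta; ring. }
  assert (SB0 : smooth2 U B0).
  { assert (Sfk : smooth2 U (fun u v => f (k u v)))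
      by exact (smooth2_Derive_n_comp U U_open f f_smooth 0 k Sk).
    unfold B0; smooth_auto. }
  exists (fun u v => B0 u v + B1 u v).
  refine (conj _ (conj _ _)).
  - smooth_auto.
  - intros u v Huv Z1 Z2.
    assert (Znu : vanishes_near nu u v).
    { unfold vanishes_near in *; generalize (filter_and _ _ Z1 Z2); apply filter_imp; intros v' [E1 E2].
      change (Y1 u v' = 0) in E1; change (Y2 u v' = 0) in E2.
      rewrite Enu, E1, E2; unfold Rdiv; ring. }
    assert (ZN : vanishes_near N u v).
    { unfold vanishes_near in *; revert Znu; apply filter_imp; intros v' E; unfold N; rewrite E; ring. }
    assert (Zw : vanishes_near w u v).
    { assert (Znu1 := vanishes_near_pd _ _ _ Znu).
      unfold vanishes_near in *; generalize (filter_and _ _ Znu Znu1); apply filter_imp.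
      intros v' [E1 E2]; unfold w; rewrite E1, E2; ring. }
    assert (ZP : vanishes_near P u v).
    { assert (Zw1 := vanishes_near_pd _ _ _ Zw).
      unfold vanishes_near in *; generalize (filter_and _ _ Znu (filter_and _ _ Zw Zw1)).
      apply filter_imp; intros v' (E1 & E2 & E3); unfold P; rewrite E1, E2, E3; ring. }
    assert (ZP1 := vanishes_near_pd _ _ _ ZP). assert (ZP2 := vanishes_near_pd _ _ _ ZP1).
    assert (ZN1 := vanishes_near_pd _ _ _ ZN).
    unfold vanishes_near in *.
    apply locally_singleton in Z1, Z2, Zw, ZP, ZP1, ZP2, ZN, ZN1.
    change (Y1 u v = 0) in Z1; change (Y2 u v = 0) in Z2.
    rewrite ZB1; [|exact ZN| |exact ZP| |].
    + unfold B0, m; rewrite Z1, Z2, Zw; unfold Rdiv; ring.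
    + unfold arc_derivative; rewrite ZN1; unfold Rdiv; ring.
    + unfold arc_derivative; rewrite ZP1; unfold Rdiv; ring.
    + unfold tau; rewrite ZP1, ZP2; unfold Rdiv; ring.
  - assert (TB : isd U Time (fun u v => B0 u v + B1 u v) _) by (apply isd_plus; eassumption).
    eapply isd_eq; [exact Dens|].
    intros u v Huv; rewrite (pd_isd U Time _ _ TB u v Huv); cbn beta.
    unfold N; field.
Qed.

End FirstVariation.

(** * Affine frames and the local invariants *)

Lemma in_dom_open a b t : in_dom a b t -> locally t (in_dom a b).
Proof.
  intros [Ha Hb]; apply filter_and; [apply (open_Rbar_gt' t a Ha)|apply (open_Rbar_lt' t b Hb)].
Qed.

Definition strip (a b : Rbar) (delta : R) (u v : R) : Prop := Rabs u < delta /\ in_dom a b v.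

Lemma strip_open a b delta : open2 (strip a b delta).
Proof.
  intros u v [Hu Hv]; apply locally_2d_locally.
  destruct (in_dom_open a b v Hv) as [r Hr].
  assert (H : 0 < delta - Rabs u) by lra.
  exists (mkposreal _ (Rmin_pos _ _ H (cond_pos r))); intros [u' v'] [Bu Bv]; split; simpl in *.
  - assert (B : Rabs (u' - u) < delta - Rabs u)
      by (eapply Rlt_le_trans; [exact Bu|apply Rmin_l]).
    replace u' with ((u' - u) + u) by ring. eapply Rle_lt_trans; [apply Rabs_triang|lra].
  - apply Hr; eapply Rlt_le_trans; [exact Bv|apply Rmin_r].
Qed.

Lemma smooth2_lift U a b g : open2 U -> (forall u v, U u v -> in_dom a b v) ->
  smooth_on a b g -> smooth2 U (fun _ v => g v).
Proof.
  intros U_open HU Hg; apply (smooth2_comp U U_open g (fun _ v => v)).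
  - intros n u v Huv; apply Hg, (HU u v Huv).
  - exact (smooth2_coord U U_open Time).
Qed.

Lemma smooth_on_slice U a b u F : (forall t, in_dom a b t -> U u t) ->
  smooth2 U F -> smooth_on a b (F u).
Proof.
  intros HU HF n; revert F HF; induction n as [|n IH]; intros F HF t Ht; [exact I|].
  destruct n as [|n].
  - exact (ex_intro _ _ (smooth2_isd U Time F HF u t (HU t Ht))).
  - assert (H := IH (pd Time F) (smooth2_pd U Time F HF) t Ht).
    eapply ex_derive_ext; [|exact H]; intro y; rewrite <- (Nat.add_1_r n).
    exact (Derive_n_comp (F u) n 1 y).
Qed.

Lemma lin_indep_det v1 v2 w1 w2 : lin_indep (v1, v2) (w1, w2) <-> v1 * w2 - v2 * w1 <> 0.
Proof.
  assert (E : forall c d, plus (scal c (v1, v2)) (scal d (w1, w2))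
     = (c * v1 + d * w1, c * v2 + d * w2)) by reflexivity.
  split.
  - intros H D.
    assert (C : forall c d, c * v1 + d * w1 = 0 -> c * v2 + d * w2 = 0 -> c = 0 /\ d = 0).
    { intros c d H1 H2; apply H; rewrite E, H1, H2; reflexivity. }
    destruct (C w2 (- v2)) as [W2 V2]; [lra|lra|].
    destruct (C w1 (- v1)) as [W1 V1]; [lra|lra|].
    destruct (C 1 0); [rewrite W1; lra|rewrite W2; lra|lra].
  - intros D c d H; rewrite E in H; injection H as H1 H2.
    apply (vectors_independent v1 v2 w1 w2); assumption.
Qed.

Section Frame.

Variables (a b : Rbar) (z : R -> R * R).
Hypothesis z_smooth : smooth_curve a b z.

Let U (_ v : R) := in_dom a b v.
Let x1 (_ v : R) := fst (z v).
Let x2 (_ v : R) := snd (z v).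

Lemma cylinder_open : open2 U.
Proof.
  intros u v Huv; destruct (in_dom_open a b v Huv) as [r Hr].
  exists r; intros u' v' _ Hv; apply Hr, Hv.
Qed.

Let U_open := cylinder_open.

Lemma cylinder_smooth g : smooth_on a b g -> smooth2 U (fun _ v => g v).
Proof. apply smooth2_lift; [exact U_open|auto]. Qed.

Lemma wronskian_neq0 : nondegenerate a b z <-> (forall u v, U u v -> wronskian x1 x2 u v <> 0).
Proof.
  split.
  - intros H u v Huv; specialize (H v Huv); apply lin_indep_det in H; exact H.
  - intros H v Hv; apply lin_indep_det, (H 0 v Hv).
Qed.

Section Invariants.

Variable E : frame_data.
Hypothesis E_frame : is_affine_frame a b z E.

Let rho (_ v : R) := omega E v.
Let l (_ v : R) := ell E v.
Let a1 (_ v : R) := fst (e1 E v).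
Let a2 (_ v : R) := snd (e1 E v).
Let b1 (_ v : R) := fst (e2 E v).
Let b2 (_ v : R) := snd (e2 E v).
Let dt u v := a1 u v * b2 u v - a2 u v * b1 u v.

Lemma frame_omega_pos t : in_dom a b t -> 0 < omega E t.
Proof.
  intro Ht; destruct E_frame as (_ & _ & _ & _ & H); destruct (H t Ht) as (I & (c & c0 & Hc) & V & _).
  rewrite V in Hc.
  destruct (e1 E t) as [v1 v2] eqn:E1, (e2 E t) as [w1 w2].
  apply lin_indep_det in I.
  assert (H1 : v1 = c * (omega E t * v1)) by exact (f_equal fst Hc).
  assert (H2 : v2 = c * (omega E t * v2)) by exact (f_equal snd Hc).
  assert (K : c * omega E t = 1).
  { destruct (Req_dec v1 0) as [Z1|Z1].
    - assert (Z2 : v2 <> 0) by (intro Z2; apply I; rewrite Z1, Z2; ring).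
      apply (Rmult_eq_reg_r v2); [lra|exact Z2].
    - apply (Rmult_eq_reg_r v1); [lra|exact Z1]. }
  apply (Rmult_lt_reg_l c); [exact c0|lra].
Qed.

Lemma frame_equations :
  smooth2 U rho /\ smooth2 U l /\
  isd U Time x1 (fun u v => rho u v * a1 u v) /\ isd U Time x2 (fun u v => rho u v * a2 u v) /\
  isd U Time a1 (fun u v => rho u v * b1 u v) /\ isd U Time a2 (fun u v => rho u v * b2 u v) /\
  isd U Time b1 (fun u v => - (l u v * rho u v * a1 u v)) /\
  isd U Time b2 (fun u v => - (l u v * rho u v * a2 u v)) /\
  (forall u v, U u v -> dt u v <> 0).
Proof.
  destruct z_smooth as [z1s z2s].
  destruct E_frame as ((a1s & a2s) & (b1s & b2s) & rs & ls & H).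
  assert (eqn : forall F F', smooth_on a b F -> (forall v, in_dom a b v -> Derive F v = F' v) ->
     isd U Time (fun _ v => F v) (fun _ v => F' v)).
  { intros F F' SF HF.
    eapply isd_eq; [exact (smooth2_isd U Time _ (cylinder_smooth F SF))|].
    intros u v Huv; exact (HF v Huv). }
  split; [exact (cylinder_smooth (omega E) rs)|]. split; [exact (cylinder_smooth (ell E) ls)|].
  split; [|split; [|split; [|split; [|split; [|split]]]]].
  - apply (eqn _ (fun v => omega E v * fst (e1 E v)) z1s); intros v Hv; destruct (H v Hv) as (_ & _ & V & _).
    exact (f_equal fst V).
  - apply (eqn _ (fun v => omega E v * snd (e1 E v)) z2s); intros v Hv; destruct (H v Hv) as (_ & _ & V & _).
    exact (f_equal snd V).
  - apply (eqn _ (fun v => omega E v * fst (e2 E v)) a1s); intros v Hv; destruct (H v Hv) as (_ & _ & _ & V & _).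
    exact (f_equal fst V).
  - apply (eqn _ (fun v => omega E v * snd (e2 E v)) a2s); intros v Hv; destruct (H v Hv) as (_ & _ & _ & V & _).
    exact (f_equal snd V).
  - apply (eqn _ (fun v => - (ell E v * omega E v * fst (e1 E v))) b1s); intros v Hv; destruct (H v Hv) as (_ & _ & _ & _ & V).
    apply (f_equal fst) in V. simpl in V. rewrite V. unfold scal; simpl; unfold mult; simpl.
    ring.
  - apply (eqn _ (fun v => - (ell E v * omega E v * snd (e1 E v))) b2s); intros v Hv; destruct (H v Hv) as (_ & _ & _ & _ & V).
    apply (f_equal snd) in V. simpl in V. rewrite V. unfold scal; simpl; unfold mult; simpl.
    ring.
  - intros u v Hv; destruct (H v Hv) as (I & _).
    unfold dt, a1, a2, b1, b2.
    destruct (e1 E v) as [v1 v2], (e2 E v) as [w1 w2]; apply lin_indep_det, I.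
Qed.

(** Differentiating [x' = omega e1] along the frame expresses the first three derivatives of the curve
    in [e1], [e2]; det(e1, e2) is constant and cancels from the quotients. *)
Lemma frame_invariants :
  (forall u v, U u v -> wronskian x1 x2 u v = rho u v ^ 3 * dt u v) /\
  (forall u v, U u v -> dt u v <> 0) /\
  (forall u v, U u v -> speed_log_derivative x1 x2 u v = pd Time rho u v / rho u v) /\
  (forall u v, U u v -> scaled_affine_curvature x1 x2 u v = rho u v ^ 2 * l u v).
Proof.
  destruct frame_equations as (Sr & Sl & X1 & X2 & A1 & A2 & B1 & B2 & D0).
  assert (Tr := smooth2_isd U Time rho Sr).
  assert (Tr1 := smooth2_isd U Time _ (smooth2_pd U Time rho Sr)).
  assert (r0 : forall u v, U u v -> rho u v <> 0)
    by (intros; apply Rgt_not_eq, frame_omega_pos; assumption).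
  assert (second : forall x A B, isd U Time x (fun u v => rho u v * A u v) ->
     isd U Time A (fun u v => rho u v * B u v) ->
     isd U Time (pd Time x) (fun u v => pd Time rho u v * A u v + rho u v ^ 2 * B u v)).
  { intros x A B Hx HA; apply (isd_ext U U_open Time (fun u v => rho u v * A u v)).
    - intros u v Huv; symmetry; apply (pd_isd U Time x _ Hx u v Huv).
    - eapply isd_eq; [isd_auto|]. intros; cbn beta; ring. }
  assert (third : forall x A B, isd U Time x (fun u v => rho u v * A u v) ->
     isd U Time A (fun u v => rho u v * B u v) ->
     isd U Time B (fun u v => - (l u v * rho u v * A u v)) ->
     isd U Time (pd Time (pd Time x)) (fun u v =>
       (pd Time (pd Time rho) u v - rho u v ^ 3 * l u v) * A u v
       + 3 * rho u v * pd Time rho u v * B u v)).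
  { intros x A B Hx HA HB.
    apply (isd_ext U U_open Time
      (fun u v => pd Time rho u v * A u v + rho u v * rho u v * B u v)).
    - intros u v Huv; rewrite (pd_isd U Time _ _ (second x A B Hx HA) u v Huv); ring.
    - eapply isd_eq; [isd_auto|]. intros; cbn beta; ring. }
  assert (X11 := second _ _ _ X1 A1). assert (X21 := second _ _ _ X2 A2).
  assert (X12 := third _ _ _ X1 A1 B1). assert (X22 := third _ _ _ X2 A2 B2).
  assert (EW : forall u v, U u v -> wronskian x1 x2 u v = rho u v ^ 3 * dt u v).
  { intros u v Huv; unfold wronskian, dt.
    rewrite (pd_isd U Time _ _ X1 u v Huv), (pd_isd U Time _ _ X2 u v Huv),
      (pd_isd U Time _ _ X11 u v Huv), (pd_isd U Time _ _ X21 u v Huv); ring. }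
  assert (TW : isd U Time (wronskian x1 x2)
     (fun u v => 3 * rho u v ^ 2 * pd Time rho u v * dt u v)).
  { apply (isd_ext U U_open Time (fun u v => rho u v * rho u v * rho u v * dt u v)).
    - intros u v Huv; rewrite (EW u v Huv); ring.
    - unfold dt; eapply isd_eq; [isd_auto|]. intros; cbn beta; ring. }
  assert (Ep : forall u v, U u v -> speed_log_derivative x1 x2 u v = pd Time rho u v / rho u v).
  { intros u v Huv; unfold speed_log_derivative; rewrite (EW u v Huv), (pd_isd U Time _ _ TW u v Huv).
    field; auto. }
  assert (Tp : isd U Time (speed_log_derivative x1 x2)
     (fun u v => (pd Time (pd Time rho) u v * rho u v - pd Time rho u v ^ 2) / rho u v ^ 2)).
  { apply (isd_ext U U_open Time (fun u v => pd Time rho u v / rho u v)).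
    - intros u v Huv; symmetry; apply Ep, Huv.
    - eapply isd_eq; [isd_auto; assumption|]. intros; cbn beta; field; auto. }
  refine (conj EW (conj D0 (conj Ep _))).
  intros u v Huv; unfold scaled_affine_curvature.
  rewrite (EW u v Huv), (pd_isd U Time _ _ Tp u v Huv), (Ep u v Huv),
    (pd_isd U Time _ _ X11 u v Huv), (pd_isd U Time _ _ X21 u v Huv),
    (pd_isd U Time _ _ X12 u v Huv), (pd_isd U Time _ _ X22 u v Huv).
  specialize (D0 u v Huv); revert D0; unfold dt; intro D0; field; auto.
Qed.

Lemma frame_length u t : in_dom a b t -> length_density x1 x2 u t = ga_length_element E t.
Proof.
  intro Ht; destruct frame_invariants as (_ & _ & _ & Eq).
  unfold length_density, ga_length_element, ga_sign; rewrite (Eq u t Ht).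
  assert (r0 := frame_omega_pos t Ht).
  rewrite Rabs_mult, sqrt_mult by apply Rabs_pos.
  rewrite (Rabs_right (rho u t ^ 2)) by apply Rle_ge, pow2_ge_0.
  unfold rho; rewrite sqrt_pow2 by lra. rewrite Rmult_comm; f_equal; f_equal; unfold l.
  destruct (Rtotal_order (ell E t) 0) as [H|[H|H]].
  - rewrite Rabs_left, sign_eq_m1; lra.
  - rewrite H, Rabs_R0; ring.
  - rewrite Rabs_right, sign_eq_1; lra.
Qed.

Lemma frame_curvature u t : in_dom a b t -> ell E t <> 0 ->
  curvature x1 x2 u t = ga_curvature E t.
Proof.
  intros Ht l0; destruct frame_invariants as (_ & _ & Ep & Eq).
  destruct frame_equations as (Sr & Sl & _).
  assert (Tr := smooth2_isd U Time rho Sr). assert (Tl := smooth2_isd U Time l Sl).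
  assert (Tq : isd U Time (scaled_affine_curvature x1 x2) (fun u v =>
     2 * rho u v * pd Time rho u v * l u v + rho u v ^ 2 * pd Time l u v)).
  { apply (isd_ext U U_open Time (fun u v => rho u v * rho u v * l u v)).
    - intros u' v' H; rewrite (Eq u' v' H); ring.
    - eapply isd_eq; [isd_auto|]. intros; cbn beta; ring. }
  unfold curvature, ga_curvature.
  rewrite (frame_length u t Ht), (pd_isd U Time _ _ Tq u t Ht), (Eq u t Ht), (Ep u t Ht).
  unfold Rdiv at 1 4; f_equal.
  change (Derive (ell E) t) with (pd Time l u t). change (ell E t) with (l u t).
  field; split; [exact l0|]. apply Rgt_not_eq, frame_omega_pos, Ht.
Qed.

Lemma frame_sign u t : in_dom a b t -> ell E t <> 0 ->
  curve_sign x1 x2 u t = ga_sign E t.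
Proof.
  intros Ht l0; destruct frame_invariants as (_ & _ & _ & Eq).
  assert (r0 := frame_omega_pos t Ht).
  unfold curve_sign, length_density.
  rewrite pow2_sqrt by apply Rabs_pos. rewrite (Eq u t Ht).
  unfold rho, l, ga_sign; rewrite Rabs_mult.
  rewrite (Rabs_right (omega E t ^ 2)) by apply Rle_ge, pow2_ge_0.
  destruct (Rtotal_order (ell E t) 0) as [H|[H|H]]; [|contradiction|].
  - rewrite Rabs_left, sign_eq_m1 by lra; field; lra.
  - rewrite Rabs_right, sign_eq_1 by lra; field; lra.
Qed.

End Invariants.

(** This is the cube root of |W|, which normalizes det(e1, e2) to be 1 or -1. *)
Definition canonical_omega (t : R) : R := exp (/ 6 * ln (wronskian x1 x2 0 t ^ 2)).

Definition canonical_frame : frame_data :=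
  let e1 t := (pd Time x1 0 t / canonical_omega t, pd Time x2 0 t / canonical_omega t) in
  FrameData e1
    (fun t => (Derive (fun v => fst (e1 v)) t / canonical_omega t,
               Derive (fun v => snd (e1 v)) t / canonical_omega t))
    canonical_omega
    (fun t => scaled_affine_curvature x1 x2 0 t / canonical_omega t ^ 2).

(** With this [omega] one has omega' = p omega, so [e1 = T / omega] and [e2 = n / omega ^ 2], and the
    frame equations are the structure equations of [moving_frame]. *)
Lemma canonical_frame_is_frame : nondegenerate a b z -> is_affine_frame a b z canonical_frame.
Proof.
  intro nondeg; assert (W0 := proj1 wronskian_neq0 nondeg).
  assert (Sx1 : smooth2 U x1) by apply (cylinder_smooth _ (proj1 z_smooth)).
  assert (Sx2 : smooth2 U x2) by apply (cylinder_smooth _ (proj2 z_smooth)).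
  set (W := wronskian x1 x2). set (p := speed_log_derivative x1 x2). set (q := scaled_affine_curvature x1 x2).
  set (T1 := pd Time x1). set (T2 := pd Time x2).
  set (n1 := fun u v => pd Time T1 u v - p u v * T1 u v).
  set (n2 := fun u v => pd Time T2 u v - p u v * T2 u v).
  assert (SW : smooth2 U W) by (apply wronskian_smooth; assumption).
  assert (Sp : smooth2 U p) by (apply speed_log_derivative_smooth; assumption).
  assert (Sq : smooth2 U q) by (apply scaled_affine_curvature_smooth; assumption).
  assert (ST1 : smooth2 U T1) by (apply smooth2_pd; assumption).
  assert (ST2 : smooth2 U T2) by (apply smooth2_pd; assumption).
  set (r := fun (_ v : R) => canonical_omega v).
  assert (rpos : forall u v, 0 < r u v) by (intros; apply exp_pos).
  assert (r0 : forall u v, U u v -> r u v <> 0) by (intros; apply Rgt_not_eq, rpos).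
  assert (Ir : forall i, isd U i r (fun u v => r u v * match i with Eta => 0 | Time => p u v end)).
  { intros [|].
    - intros u v _; rewrite Rmult_0_r.
      exact (is_derive_const (K := R_AbsRing) (V := R_NormedModule) (canonical_omega v) u).
    - eapply isd_eq.
      + apply (isd_comp U Time (fun y => exp (/ 6 * ln (y ^ 2)))
          (fun y => exp (/ 6 * ln (y ^ 2)) * (/ (3 * y))) W).
        * intros u v Huv; specialize (W0 u v Huv); fold W in W0.
          assert (P : 0 < W u v ^ 2) by (apply pow2_gt_0; exact W0).
          auto_derive; [exact P|]. simpl in P |- *. field; exact W0.
        * apply smooth2_isd, SW.
      + intros u v Huv; specialize (W0 u v Huv); fold W in W0.
        unfold p, speed_log_derivative, r, canonical_omega; fold W.
        change (W 0 v) with (W u v); field; exact W0. }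
  assert (Sr : smooth2 U r).
  { apply (smooth2_log_derivative U U_open r
      (fun i u v => match i with Eta => 0 | Time => p u v end)).
    - intros u v Huv; specialize (W0 u v Huv); fold W in W0.
      assert (P : 0 < W u v ^ 2) by (apply pow2_gt_0; exact W0).
      apply (continuity_1d_2d_pt_comp (fun y => exp (/ 6 * ln (y ^ 2))) W).
      + apply continuity_pt_filterlim, (ex_derive_continuous (fun y => exp (/ 6 * ln (y ^ 2)))).
        auto_derive; exact P.
      + apply (smooth2_cont U); assumption.
    - exact Ir.
    - intros [|]; [apply smooth2_const, U_open|exact Sp]. }
  assert (Tr := Ir Time). simpl in Tr.
  destruct (moving_frame U U_open x1 x2 Sx1 Sx2 W0) as (HT1' & HT2' & Hn1' & Hn2' & Hdet).
  assert (HT1 : isd U Time T1 (fun u v => p u v * T1 u v + n1 u v)) by exact HT1'.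
  assert (HT2 : isd U Time T2 (fun u v => p u v * T2 u v + n2 u v)) by exact HT2'.
  assert (Hn1 : isd U Time n1 (fun u v => 2 * p u v * n1 u v - q u v * T1 u v)) by exact Hn1'.
  assert (Hn2 : isd U Time n2 (fun u v => 2 * p u v * n2 u v - q u v * T2 u v)) by exact Hn2'.
  clear HT1' HT2' Hn1' Hn2'.
  assert (Sn1 : smooth2 U n1) by (unfold n1; smooth_auto).
  assert (Sn2 : smooth2 U n2) by (unfold n2; smooth_auto).
  assert (r2 : forall u v, U u v -> r u v * r u v <> 0)
    by (intros u v _; specialize (rpos u v); nra).
  set (A1 := fun u v => T1 u v / r u v). set (A2 := fun u v => T2 u v / r u v).
  assert (IA1 : isd U Time A1 (fun u v => n1 u v / r u v)).
  { unfold A1; eapply isd_eq; [isd_auto; assumption|]. intros; cbn beta; field; auto. }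
  assert (IA2 : isd U Time A2 (fun u v => n2 u v / r u v)).
  { unfold A2; eapply isd_eq; [isd_auto; assumption|]. intros; cbn beta; field; auto. }
  set (B1 := fun u v => pd Time A1 u v / r u v). set (B2 := fun u v => pd Time A2 u v / r u v).
  assert (SA1 : smooth2 U A1) by (unfold A1; smooth_auto).
  assert (SA2 : smooth2 U A2) by (unfold A2; smooth_auto).
  assert (SB1 : smooth2 U B1) by (unfold B1; smooth_auto).
  assert (SB2 : smooth2 U B2) by (unfold B2; smooth_auto).
  assert (EA1 := pd_isd U Time _ _ IA1). assert (EA2 := pd_isd U Time _ _ IA2).
  assert (IB1 : isd U Time B1 (fun u v => - (q u v * T1 u v) / r u v ^ 2)).
  { apply (isd_ext U U_open Time (fun u v => n1 u v / (r u v * r u v))).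
    - intros u v Huv; unfold B1; rewrite (EA1 u v Huv); field; auto.
    - eapply isd_eq; [isd_auto; assumption|].
      intros; cbn beta; field; auto. }
  assert (IB2 : isd U Time B2 (fun u v => - (q u v * T2 u v) / r u v ^ 2)).
  { apply (isd_ext U U_open Time (fun u v => n2 u v / (r u v * r u v))).
    - intros u v Huv; unfold B2; rewrite (EA2 u v Huv); field; auto.
    - eapply isd_eq; [isd_auto; assumption|].
      intros; cbn beta; field; auto. }
  assert (slice : forall F, smooth2 U F -> smooth_on a b (F 0)).
  { intros F SF; apply (smooth_on_slice U); [auto|exact SF]. }
  split; [|split; [|split; [|split]]].
  - split; [exact (slice _ SA1)|exact (slice _ SA2)].
  - split; [exact (slice _ SB1)|exact (slice _ SB2)].
  - exact (slice _ Sr).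
  - assert (S : smooth2 U (fun u v => q u v / (r u v ^ 2))).
    { apply (smooth2_ext U U_open (fun u v => q u v / (r u v * r u v))); [|smooth_auto].
      intros; f_equal; ring. }
    exact (slice _ S).
  - intros t Ht; assert (Hr := rpos 0 t).
    assert (V : velocity z t = scal (canonical_omega t) (e1 canonical_frame t)).
    { apply injective_projections.
      - change (T1 0 t = r 0 t * A1 0 t); unfold A1; field; lra.
      - change (T2 0 t = r 0 t * A2 0 t); unfold A2; field; lra. }
    refine (conj _ (conj _ (conj V (conj _ _)))).
    + change (lin_indep (A1 0 t, A2 0 t) (B1 0 t, B2 0 t)); apply lin_indep_det.
      unfold B1, B2; rewrite (EA1 0 t Ht), (EA2 0 t Ht).
      specialize (W0 0 t Ht); rewrite <- (Hdet 0 t Ht) in W0.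
      change (T1 0 t * n2 0 t - T2 0 t * n1 0 t <> 0) in W0; unfold A1, A2.
      replace (T1 0 t / r 0 t * (n2 0 t / r 0 t / r 0 t)
               - T2 0 t / r 0 t * (n1 0 t / r 0 t / r 0 t))
        with ((T1 0 t * n2 0 t - T2 0 t * n1 0 t) / r 0 t ^ 3) by (field; lra).
      apply Rmult_integral_contrapositive; split; [exact W0|].
      apply Rinv_neq_0_compat, pow_nonzero; lra.
    + exists (/ canonical_omega t); split; [apply Rinv_0_lt_compat, Hr|].
      rewrite V, scal_assoc. unfold mult; simpl.
      rewrite Rinv_l by exact (r0 0 t Ht). symmetry; apply (scal_one (e1 canonical_frame t)).
    + apply injective_projections.
      * change (pd Time A1 0 t = r 0 t * B1 0 t); unfold B1; field; lra.
      * change (pd Time A2 0 t = r 0 t * B2 0 t); unfold B2; field; lra.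
    + assert (Q1 := pd_isd U Time _ _ IB1 0 t Ht). assert (Q2 := pd_isd U Time _ _ IB2 0 t Ht).
      apply injective_projections.
      * change (pd Time B1 0 t = - (q 0 t / r 0 t ^ 2) * r 0 t * A1 0 t).
        rewrite Q1; unfold A1; field; lra.
      * change (pd Time B2 0 t = - (q 0 t / r 0 t ^ 2) * r 0 t * A2 0 t).
        rewrite Q2; unfold A2; field; lra.
Qed.

End Frame.

(** * First variation of the functional *)

Lemma in_dom_convex a b c d t : in_dom a b c -> in_dom a b d -> c <= t <= d -> in_dom a b t.
Proof.
  intros [Hc _] [_ Hd] [H1 H2]; split.
  - apply (Rbar_lt_le_trans a c t Hc H1).
  - apply (Rbar_le_lt_trans t d b H2 Hd).
Qed.

Lemma arc_derivative_slice a b s sg F g u :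
  (forall t, in_dom a b t -> sg u t = Derive s t) ->
  (forall t, in_dom a b t -> F u t = g t) ->
  forall t, in_dom a b t -> arc_derivative sg F u t = deriv_wrt s g t.
Proof.
  intros Hsg HF t Ht; unfold arc_derivative, deriv_wrt; rewrite (Hsg t Ht); f_equal.
  apply Derive_ext_loc; generalize (in_dom_open a b t Ht); apply filter_imp, HF.
Qed.

Lemma euler_lagrange_slice a b f s e sg k u eps kappa :
  (forall t, in_dom a b t -> sg u t = Derive s t) ->
  (forall t, in_dom a b t -> e u t = eps) ->
  (forall t, in_dom a b t -> k u t = kappa t) ->
  let D := deriv_wrt s in
  let G := fun t =>
    4 * Derive_n f 4 (kappa t) * (D kappa t) ^ 3
    + 12 * Derive_n f 3 (kappa t) * D kappa t * D (D kappa) t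
    + Derive_n f 2 (kappa t) *
        (4 * D (D (D kappa)) t - D kappa t * (kappa t) ^ 2 + 16 * eps * D kappa t)
    - Derive_n f 1 (kappa t) * kappa t * D kappa t
    + f (kappa t) * D kappa t in
  forall t, in_dom a b t -> euler_lagrange f e sg k u t =
    D (D G) t + 3 / 2 * D G t * kappa t + 1 / 2 * G t * D kappa t
    + 1 / 2 * G t * (kappa t) ^ 2 + eps * G t.
Proof.
  intros Hsg He Hk D G.
  assert (HD := fun F g => arc_derivative_slice a b s sg F g u Hsg).
  assert (K1 := HD _ _ Hk). assert (K2 := HD _ _ K1). assert (K3 := HD _ _ K2).
  assert (HG : forall t, in_dom a b t -> momentum f e sg k u t = G t).
  { intros t Ht; unfold momentum; cbv zeta.
    rewrite (K1 t Ht), (K2 t Ht), (K3 t Ht), (Hk t Ht), (He t Ht); reflexivity. }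
  assert (G1 := HD _ _ HG). assert (G2 := HD _ _ G1).
  intros t Ht; unfold euler_lagrange; cbv zeta.
  rewrite (G2 t Ht), (G1 t Ht), (K1 t Ht), (HG t Ht), (Hk t Ht), (He t Ht); reflexivity.
Qed.

Section Deformation.

Variables (a b : Rbar) (x : R -> R * R) (X : R -> R -> R * R) (delta c d : R).
Hypothesis X_def : compact_deformation a b x X delta c d.

Let U := strip a b delta.
Let x1 u v := fst (X u v).
Let x2 u v := snd (X u v).

Lemma deformation_smooth : smooth2 U x1 /\ smooth2 U x2.
Proof.
  destruct X_def as (_ & _ & _ & _ & S & _).
  split; intros n u v [Hu Hv]; apply (S n u v Hu Hv).
Qed.

Lemma deformation_slice_smooth u : Rabs u < delta -> smooth_curve a b (X u).
Proof.
  intro Hu; destruct deformation_smooth as [S1 S2].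
  split; [apply (smooth_on_slice U a b u x1)|apply (smooth_on_slice U a b u x2)];
    auto; intros t Ht; split; assumption.
Qed.

Lemma frame_ell_neq0 z E : no_inflection a b z -> is_affine_frame a b z E ->
  forall t, in_dom a b t -> ell E t <> 0.
Proof. intros H HE t Ht l0; apply (H t Ht); exists E; auto. Qed.

Lemma deformation_wronskian_neq0 u v : U u v -> wronskian x1 x2 u v <> 0.
Proof.
  intros [Hu Hv]; destruct X_def as (_ & _ & _ & _ & _ & N & _).
  exact (proj1 (wronskian_neq0 a b (X u)) (proj1 (N u Hu)) u v Hv).
Qed.

Lemma deformation_curvature_neq0 (E : R -> frame_data) :
  (forall eta, Rabs eta < delta -> is_affine_frame a b (X eta) (E eta)) ->
  forall u v, U u v -> scaled_affine_curvature x1 x2 u v <> 0.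
Proof.
  intros HE u v [Hu Hv]; destruct X_def as (_ & _ & _ & _ & _ & N & _).
  destruct (frame_invariants a b (X u) (deformation_slice_smooth u Hu) (E u) (HE u Hu))
    as (_ & _ & _ & Q).
  intro Z; specialize (Q u v Hv); change (scaled_affine_curvature x1 x2 u v = omega (E u) v ^ 2 * ell (E u) v) in Q.
  rewrite Z in Q; symmetry in Q; apply Rmult_integral in Q; destruct Q as [Q|Q].
  - revert Q; apply pow_nonzero, Rgt_not_eq.
    exact (frame_omega_pos a b (X u) (E u) (HE u Hu) v Hv).
  - exact (frame_ell_neq0 (X u) (E u) (proj2 (N u Hu)) (HE u Hu) v Hv Q).
Qed.

Lemma variation_vanishes v : in_dom a b v -> v < c \/ d < v ->
  vanishes_near (pd Eta x1) 0 v /\ vanishes_near (pd Eta x2) 0 v.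
Proof.
  intros Hv Hcd; destruct X_def as (d0 & _ & _ & _ & _ & _ & _ & O).
  assert (L : locally v (fun v' => in_dom a b v' /\ ~ (c <= v' <= d))).
  { apply filter_and; [apply in_dom_open, Hv|].
    destruct Hcd as [H|H].
    - generalize (open_lt c v H); apply filter_imp; intros; lra.
    - generalize (open_gt d v H); apply filter_imp; intros; lra. }
  assert (K : forall v', in_dom a b v' -> ~ (c <= v' <= d) ->
     locally 0 (fun u => X u v' = x v')).
  { intros v' H1 H2; exists (mkposreal _ d0); intros u Hu; apply O; try assumption.
    unfold ball in Hu; simpl in Hu; unfold AbsRing_ball, abs, minus, plus, opp in Hu; simpl in Hu.
    replace u with (u + - 0) by ring; exact Hu. }
  unfold vanishes_near; split; revert L; apply filter_imp; intros v' [H1 H2]; specialize (K v' H1 H2).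
  - transitivity (Derive (fun _ => fst (x v')) 0); [|apply Derive_const].
    apply Derive_ext_loc; revert K; apply filter_imp; intros u E; unfold x1; rewrite E; reflexivity.
  - transitivity (Derive (fun _ => snd (x v')) 0); [|apply Derive_const].
    apply Derive_ext_loc; revert K; apply filter_imp; intros u E; unfold x2; rewrite E; reflexivity.
Qed.

(** Used at the ends of the support of a deformation, where vanishing is known on one side only. *)
Lemma smooth2_zero_limit F t : smooth2 U F -> U 0 t ->
  (forall r, 0 < r -> exists v, Rabs (v - t) < r /\ (in_dom a b v -> F 0 v = 0)) -> F 0 t = 0.
Proof.
  intros SF Ht H; destruct (Req_dec (F 0 t) 0) as [E|E]; [exact E|exfalso].
  assert (L1 := continuity_2d_pt_neq_0 F 0 t (smooth2_cont U F 0 t SF Ht) E).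
  apply locally_2d_1d_const_x in L1.
  destruct (filter_and _ _ L1 (in_dom_open a b t (proj2 Ht))) as [r Hr].
  destruct (H r (cond_pos r)) as (v & Hv & Z); destruct (Hr v Hv) as [H1 H2]; auto.
Qed.

Lemma smooth2_slice_continuous F u t : smooth2 U F -> U u t -> continuous (F u) t.
Proof.
  intros SF Ht; apply (ex_derive_continuous (F u)).
  exact (ex_intro _ _ (smooth2_isd U Time F SF u t Ht)).
Qed.

(** The integral of the exact term of [density_first_variation] vanishes, since the deformation is zero
    next to [c] and [d] from outside. *)
Lemma first_variation f (f_smooth : forall n r, ex_derive_n f n r) (E : R -> frame_data) :
  (forall eta, Rabs eta < delta -> is_affine_frame a b (X eta) (E eta)) ->
  is_derive (fun eta => curvature_functional f c d (E eta)) 0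
    (- / 12 * RInt (fun t => curve_sign x1 x2 0 t * length_density x1 x2 0 t ^ 3
        * normal_component x1 x2 0 t
        * euler_lagrange f (curve_sign x1 x2) (length_density x1 x2) (curvature x1 x2) 0 t) c d).
Proof.
  intros HE.
  assert (U_open := strip_open a b delta). fold U in U_open.
  destruct deformation_smooth as [S1 S2].
  assert (W0 := deformation_wronskian_neq0). assert (q0 := deformation_curvature_neq0 E HE).
  destruct (density_first_variation U U_open x1 x2 S1 S2 W0 q0 f f_smooth)
    as (B & SB & ZB & IB).
  assert (Ssg : smooth2 U (length_density x1 x2)) by (apply length_density_smooth; assumption).
  assert (Sk : smooth2 U (curvature x1 x2)) by (apply curvature_smooth; assumption).
  set (Phi := fun u v => f (curvature x1 x2 u v) * length_density x1 x2 u v) in *.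
  assert (SPhi : smooth2 U Phi).
  { assert (Sfk : smooth2 U (fun u v => f (curvature x1 x2 u v)))
      by exact (smooth2_Derive_n_comp U U_open f f_smooth 0 _ Sk).
    unfold Phi; smooth_auto. }
  destruct X_def as (d0 & Hc & Hd & cd & _ & HN & _).
  assert (Hcd : forall u t, Rabs u < delta -> Rmin c d <= t <= Rmax c d -> U u t).
  { intros u t Hu Ht; rewrite Rmin_left, Rmax_right in Ht by exact cd; split; [exact Hu|].
    apply (in_dom_convex a b c d t Hc Hd Ht). }
  assert (L0 : locally 0 (fun u => Rabs u < delta)).
  { exists (mkposreal _ d0); intros u Hu.
    unfold ball in Hu; simpl in Hu; unfold AbsRing_ball, abs, minus, plus, opp in Hu; simpl in Hu.
    replace u with (u + - 0) by ring; exact Hu. }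
  assert (Z0 : Rabs 0 < delta) by (rewrite Rabs_R0; exact d0).
  apply (is_derive_ext_loc (fun u => RInt (Phi u) c d)).
  { revert L0; apply filter_imp; intros u Hu; unfold curvature_functional.
    apply RInt_ext; intros t Ht; unfold Phi.
    assert (Ut : U u t) by (apply Hcd; [exact Hu|lra]).
    assert (l0 := frame_ell_neq0 (X u) (E u) (proj2 (HN u Hu)) (HE u Hu) t (proj2 Ut)).
    assert (Sm := deformation_slice_smooth u Hu).
    f_equal; [f_equal|].
    - exact (frame_curvature a b (X u) Sm (E u) (HE u Hu) u t (proj2 Ut) l0).
    - exact (frame_length a b (X u) Sm (E u) (HE u Hu) u t (proj2 Ut)). }
  match goal with |- is_derive _ _ ?v => replace v with (RInt (fun t => Derive (fun u => Phi u t) 0) c d) end.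
  { apply is_derive_RInt_param.
    - revert L0; apply filter_imp; intros u Hu t Ht.
      exact (ex_intro _ _ (smooth2_isd U Eta Phi SPhi u t (Hcd u t Hu Ht))).
    - intros t Ht; exact (smooth2_cont U _ 0 t (smooth2_pd U Eta Phi SPhi) (Hcd 0 t Z0 Ht)).
    - revert L0; apply filter_imp; intros u Hu; apply (ex_RInt_continuous (V := R_CompleteNormedModule)).
      intros t Ht; apply smooth2_slice_continuous; [exact SPhi|apply Hcd; assumption]. }
  set (H := fun t => curve_sign x1 x2 0 t * length_density x1 x2 0 t ^ 3
        * normal_component x1 x2 0 t
        * euler_lagrange f (curve_sign x1 x2) (length_density x1 x2) (curvature x1 x2) 0 t).
  assert (EPhi : forall t, Rmin c d <= t <= Rmax c d ->
     Derive (fun u => Phi u t) 0 = pd Time B 0 t - / 12 * H t).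
  { intros t Ht; transitivity (pd Eta Phi 0 t); [reflexivity|].
    rewrite (pd_isd U Eta Phi _ IB 0 t (Hcd 0 t Z0 Ht)); unfold H; field. }
  assert (B0 : forall t, (t = c \/ t = d) -> B 0 t = 0).
  { intros t Ht; apply smooth2_zero_limit; [exact SB| |].
    - split; [exact Z0|destruct Ht as [-> | ->]; assumption].
    - intros r r0; destruct Ht as [-> | ->].
      + exists (c - r / 2); split; [rewrite Rabs_left; lra|]. intro Hv.
        destruct (variation_vanishes _ Hv) as [V1 V2]; [lra|].
        apply ZB; [split; assumption|assumption|assumption].
      + exists (d + r / 2); split; [rewrite Rabs_right; lra|]. intro Hv.
        destruct (variation_vanishes _ Hv) as [V1 V2]; [lra|].
        apply ZB; [split; assumption|assumption|assumption]. }
  assert (IB1 : is_RInt (pd Time B 0) c d 0).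
  { replace 0 with (minus (B 0 d) (B 0 c)) at 2.
    - apply (is_RInt_derive (B 0)); intros t Ht.
      + exact (smooth2_isd U Time B SB 0 t (Hcd 0 t Z0 Ht)).
      + apply smooth2_slice_continuous; [apply smooth2_pd, SB|apply Hcd; assumption].
    - rewrite (B0 c), (B0 d) by auto; unfold minus, plus, opp; simpl; ring. }
  assert (IPhi : ex_RInt (fun t => Derive (fun u => Phi u t) 0) c d).
  { apply (ex_RInt_continuous (V := R_CompleteNormedModule)); intros t Ht.
    apply (smooth2_slice_continuous (pd Eta Phi) 0); [apply smooth2_pd, SPhi|apply Hcd; assumption]. }
  assert (IH : is_RInt H c d (-12 * RInt (fun t => Derive (fun u => Phi u t) 0) c d)).
  { apply (is_RInt_ext (fun t => scal (-12) (minus (Derive (fun u => Phi u t) 0) (pd Time B 0 t)))).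
    - intros t Ht; rewrite EPhi by lra. unfold scal, minus, plus, opp; simpl; unfold mult; simpl.
      field.
    - replace (-12 * RInt (fun t => Derive (fun u => Phi u t) 0) c d)
        with (scal (-12) (minus (RInt (fun t => Derive (fun u => Phi u t) 0) c d) 0))
        by (unfold scal, minus, plus, opp; simpl; unfold mult; simpl; ring).
      apply (is_RInt_scal (V := R_NormedModule)), (is_RInt_minus (V := R_NormedModule));
        [apply (RInt_correct (V := R_CompleteNormedModule)), IPhi|exact IB1]. }
  enough (A : forall J K : R, K = -12 * J -> J = - / 12 * K)
    by exact (A _ _ (is_RInt_unique H c d _ IH)).
  intros J K ->; field.
Qed.

End Deformation.

(** * Bump functions *)

(** The whole family, rather than exp(-1/t) alone, because it is closed under differentiation up to
    linear combinations: a quadratic bound at 0 for every [n] then gives smoothness. *)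
Definition flat (n : nat) (t : R) : R :=
  if Rlt_dec 0 t then exp (- / t) * (/ t) ^ n else 0.

(** The bound 1 + z <= exp z at z = y / (n+1), raised to the power n+1. *)
Lemma pow_le_exp n y : 0 <= y -> y ^ S n <= INR (S n) ^ S n * exp y.
Proof.
  intro Hy; assert (P : 0 < INR (S n)) by (apply lt_0_INR; lia).
  set (m := INR (S n)) in *.
  assert (E : exp y = exp (y / m) ^ S n).
  { rewrite <- Rpower_pow by apply exp_pos; unfold Rpower; rewrite ln_exp; f_equal.
    fold m; field; lra. }
  rewrite E, <- Rpow_mult_distr; apply pow_incr; split; [exact Hy|].
  assert (H := exp_ineq1_le (y / m)).
  apply Rle_trans with (m * (1 + y / m)); [|apply Rmult_le_compat_l; lra].
  rewrite Rmult_plus_distr_l; replace (m * (y / m)) with y by (field; lra); lra.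
Qed.

Lemma flat_bound n t : Rabs (flat n t) <= INR (S (S n)) ^ S (S n) * t ^ 2.
Proof.
  assert (C : 0 <= INR (S (S n)) ^ S (S n)) by apply pow_le, pos_INR.
  unfold flat; destruct (Rlt_dec 0 t) as [H|H].
  - assert (Ht : 0 < / t) by (apply Rinv_0_lt_compat, H).
    rewrite Rabs_right by (apply Rle_ge, Rmult_le_pos; [left; apply exp_pos|apply pow_le; lra]).
    assert (B := pow_le_exp (S n) (/ t) (Rlt_le _ _ Ht)).
    rewrite exp_Ropp; assert (E := exp_pos (/ t)).
    apply (Rmult_le_reg_r (exp (/ t))); [exact E|].
    replace (/ exp (/ t) * (/ t) ^ n * exp (/ t)) with ((/ t) ^ n) by (field; lra).
    replace ((/ t) ^ n) with ((/ t) ^ S (S n) * t ^ 2) by (simpl; field; lra).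
    rewrite Rmult_assoc, (Rmult_comm (t ^ 2)), <- Rmult_assoc.
    apply Rmult_le_compat_r; [apply pow2_ge_0|exact B].
  - rewrite Rabs_R0; apply Rmult_le_pos; [exact C|apply pow2_ge_0].
Qed.

Lemma flat_derive n t :
  is_derive (flat n) t (flat (S (S n)) t - INR n * flat (S n) t).
Proof.
  destruct (Rtotal_order t 0) as [H|[H|H]].
  - replace (flat (S (S n)) t - INR n * flat (S n) t) with 0
      by (unfold flat; destruct (Rlt_dec 0 t); [lra|ring]).
    apply (is_derive_ext_loc (fun _ => 0)).
    + generalize (open_lt 0 t H); apply filter_imp; intros y Hy.
      unfold flat; destruct (Rlt_dec 0 y); [lra|reflexivity].
    + apply (is_derive_const (K := R_AbsRing) (V := R_NormedModule)).
  - subst t; replace (flat (S (S n)) 0 - INR n * flat (S n) 0) with 0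
      by (unfold flat; destruct (Rlt_dec 0 0); [lra|ring]).
    apply is_derive_Reals; intros eps Heps.
    set (C := INR (S (S n)) ^ S (S n)).
    assert (C0 : 0 <= C) by apply pow_le, pos_INR.
    assert (D0 : 0 < eps / (C + 1)) by (apply Rdiv_lt_0_compat; lra).
    exists (mkposreal _ D0); intros y Hy Hye; simpl in Hye.
    replace (flat n 0) with 0 by (unfold flat; destruct (Rlt_dec 0 0); lra).
    rewrite Rplus_0_l; replace ((flat n y - 0) / y - 0) with (flat n y * / y) by (field; exact Hy).
    assert (Py := Rabs_pos_lt y Hy).
    rewrite Rabs_mult, Rabs_inv.
    apply Rle_lt_trans with (C * Rabs y).
    + apply (Rmult_le_reg_r (Rabs y)); [exact Py|].
      rewrite Rmult_assoc, Rinv_l, Rmult_1_r by lra.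
      replace (C * Rabs y * Rabs y) with (C * y ^ 2) by (rewrite <- (pow2_abs y); ring).
      apply flat_bound.
    + apply Rle_lt_trans with ((C + 1) * Rabs y); [nra|].
      apply (Rmult_lt_compat_l (C + 1)) in Hye; [|lra].
      replace ((C + 1) * (eps / (C + 1))) with eps in Hye by (field; lra); exact Hye.
  - apply (is_derive_ext_loc (fun y => exp (- / y) * (/ y) ^ n)).
    + generalize (open_gt 0 t H); apply filter_imp; intros y Hy.
      unfold flat; destruct (Rlt_dec 0 y); [reflexivity|lra].
    + unfold flat; destruct (Rlt_dec 0 t); [|lra].
      auto_derive; [lra|].
      destruct n as [|n]; [simpl; field; lra|].
      rewrite <- pred_Sn; simpl pow; field; lra.
Qed.

Lemma flat_smooth m n t : ex_derive_n (flat m) n t.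
Proof.
  set (U := fun _ _ : R => True).
  assert (U_open : open2 U) by (intros u v _; apply locally_2d_forall; intros; exact I).
  assert (D : forall n m, diff_n U n (fun _ v => flat m v)).
  { clear m n; intro n; induction n as [|n IH]; intro m.
    all: assert (H0 : diff_n U 0 (fun _ v => flat m v)) by
      (intros u v _; split; [|exact I];
       apply (continuity_1d_2d_pt_comp (flat m) (fun _ v => v));
       [apply continuity_pt_filterlim, (ex_derive_continuous (flat m));
        eexists; apply flat_derive
       |apply continuity_2d_pt_id2]).
    - exact H0.
    - apply (diff_n_intro U U_open n _ (fun i u v =>
        match i with Eta => 0 | Time => flat (S (S m)) v + (- INR m) * flat (S m) v end)).
      + exact H0.
      + intros [|] u v _; [apply (is_derive_const (K := R_AbsRing) (V := R_NormedModule))|].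
        replace (flat (S (S m)) v + - INR m * flat (S m) v)
          with (flat (S (S m)) v - INR m * flat (S m) v) by ring.
        apply flat_derive.
      + intros [|]; [apply diff_n_const, U_open|].
        apply diff_n_plus; [exact U_open|apply IH|].
        apply diff_n_mult; [exact U_open|apply diff_n_const, U_open|apply IH]. }
  apply (smooth_on_slice U m_infty p_infty 0 (fun _ v => flat m v)).
  - intros; exact I.
  - intro k; apply D.
  - split; exact I.
Qed.

Lemma bump_exists a b c d : exists phi,
  smooth_on a b phi /\ (forall t, c < t < d -> 0 < phi t) /\
  (forall t, ~ (c < t < d) -> phi t = 0).
Proof.
  assert (pos : forall t, 0 < t -> 0 < flat 0 t).
  { intros t Ht; unfold flat; destruct (Rlt_dec 0 t); [|lra].
    simpl; rewrite Rmult_1_r; apply exp_pos. }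
  assert (zero : forall t, ~ 0 < t -> flat 0 t = 0).
  { intros t Ht; unfold flat; destruct (Rlt_dec 0 t); [lra|reflexivity]. }
  exists (fun t => flat 0 (t - c) * flat 0 (d - t)).
  refine (conj _ (conj _ _)).
  - set (U := fun _ v : R => in_dom a b v).
    assert (U_open : open2 U) by exact (cylinder_open a b).
    apply (smooth_on_slice U a b 0 (fun _ t => flat 0 (t - c) * flat 0 (d - t))); [auto|].
    assert (V : smooth2 U (fun _ v => v)) by exact (smooth2_coord U U_open Time).
    apply (smooth2_mult U U_open (fun _ t => flat 0 (t - c)) (fun _ t => flat 0 (d - t))).
    + apply (smooth2_comp U U_open (flat 0) (fun _ t => t - c)); [intros; apply flat_smooth|].
      smooth_auto.
    + apply (smooth2_comp U U_open (flat 0) (fun _ t => d - t)); [intros; apply flat_smooth|].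
      smooth_auto.
  - intros t Ht; apply Rmult_lt_0_compat; apply pos; lra.
  - intros t Ht; destruct (Rlt_dec c t) as [H|H].
    + rewrite (zero (d - t)) by lra; ring.
    + rewrite (zero (t - c)) by lra; ring.
Qed.

(** * Normal deformations and the Euler-Lagrange equation *)

(** Being a frame only involves the velocity of the curve, hence is local. *)
Lemma frame_restrict a b a' b' y z E :
  (forall t, in_dom a' b' t -> in_dom a b t) -> (forall t, in_dom a' b' t -> y t = z t) ->
  is_affine_frame a b z E -> is_affine_frame a' b' y E.
Proof.
  intros Hdom Hyz (SA & SB & SO & SL & H).
  assert (R : forall g, smooth_on a b g -> smooth_on a' b' g)
    by (intros g Hg n t Ht; apply Hg, Hdom, Ht).
  assert (V : forall t, in_dom a' b' t -> velocity y t = velocity z t).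
  { intros t Ht; apply injective_projections; apply Derive_ext_loc;
      generalize (in_dom_open a' b' t Ht); apply filter_imp; intros v Hv; rewrite (Hyz v Hv);
      reflexivity. }
  split; [split; apply R; apply SA|]. split; [split; apply R; apply SB|].
  split; [apply R, SO|]. split; [apply R, SL|].
  intros t Ht; rewrite (V t Ht); apply H, Hdom, Ht.
Qed.

(** Equal to 9 W^3 q, but polynomial in the derivatives of the curve: it is continuous in eta without
    assuming W <> 0, and it is nonzero exactly when both W and q are. *)
Definition curvature_discriminant (x1 x2 : R -> R -> R) (u v : R) : R :=
  let W := wronskian x1 x2 in
  W u v * (9 * (pd Time (pd Time x1) u v * pd Time (pd Time (pd Time x2)) u v
                - pd Time (pd Time x2) u v * pd Time (pd Time (pd Time x1)) u v) * W u v
           + 3 * W u v * pd Time (pd Time W) u v - 5 * (pd Time W u v * pd Time W u v)).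

Lemma curvature_discriminant_smooth U x1 x2 : open2 U -> smooth2 U x1 -> smooth2 U x2 ->
  smooth2 U (curvature_discriminant x1 x2).
Proof.
  intros U_open S1 S2; assert (SW := wronskian_smooth U U_open x1 x2 S1 S2).
  unfold curvature_discriminant; cbv zeta; smooth_auto.
Qed.

Lemma curvature_discriminant_eq U x1 x2 u v : open2 U -> smooth2 U x1 -> smooth2 U x2 -> U u v ->
  wronskian x1 x2 u v <> 0 ->
  curvature_discriminant x1 x2 u v = 9 * wronskian x1 x2 u v ^ 3 * scaled_affine_curvature x1 x2 u v.
Proof.
  intros U_open S1 S2 Huv W0.
  set (W := wronskian x1 x2) in *.
  assert (SW : smooth2 U W) by (apply wronskian_smooth; assumption).
  set (U' := fun u v => U u v /\ W u v <> 0).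
  assert (U'_open : open2 U').
  { intros u' v' [H1 H2]; apply locally_2d_and; [apply U_open, H1|].
    apply continuity_2d_pt_neq_0; [apply (smooth2_cont U); assumption|exact H2]. }
  assert (R : forall F, smooth2 U F -> smooth2 U' F) by (intros F SF n u' v' [H _]; apply SF, H).
  assert (TW := smooth2_isd U' Time W (R W SW)).
  assert (TW1 := smooth2_isd U' Time _ (smooth2_pd U' Time W (R W SW))).
  assert (Tp : isd U' Time (speed_log_derivative x1 x2) (fun u v =>
     (pd Time (pd Time W) u v * W u v - pd Time W u v ^ 2) / (3 * W u v ^ 2))).
  { unfold speed_log_derivative; fold W; eapply isd_eq; [isd_auto|].
    - intros u' v' [_ H]; lra.
    - intros u' v' [_ H]; cbn beta; field; exact H. }
  unfold scaled_affine_curvature; fold W.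
  rewrite (pd_isd U' Time _ _ Tp u v (conj Huv W0)).
  unfold curvature_discriminant, speed_log_derivative; cbv zeta; fold W; field; exact W0.
Qed.

Lemma frame_discriminant_neq0 a b z E : smooth_curve a b z -> is_affine_frame a b z E ->
  (forall t, in_dom a b t -> ell E t <> 0) ->
  forall t u, in_dom a b t ->
  curvature_discriminant (fun _ v => fst (z v)) (fun _ v => snd (z v)) u t <> 0.
Proof.
  intros Sz HE l0 t u Ht.
  destruct (frame_invariants a b z Sz E HE) as (EW & D0 & _ & Eq).
  assert (r0 := frame_omega_pos a b z E HE t Ht).
  assert (W0 : wronskian (fun _ v => fst (z v)) (fun _ v => snd (z v)) u t <> 0).
  { rewrite (EW u t Ht); apply Rmult_integral_contrapositive; split; [|exact (D0 u t Ht)].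
    apply pow_nonzero; lra. }
  rewrite (curvature_discriminant_eq (fun _ v => in_dom a b v)); trivial.
  - rewrite (Eq u t Ht); repeat (apply Rmult_integral_contrapositive; split);
      try apply pow_nonzero; try lra; trivial; apply l0, Ht.
  - apply cylinder_open.
  - exact (cylinder_smooth a b _ (proj1 Sz)).
  - exact (cylinder_smooth a b _ (proj2 Sz)).
Qed.

(** Uniform continuity against the positive minimum of the absolute value on the compact interval. *)
Lemma nonvanishing_nearby F c d : c <= d ->
  (forall t, c <= t <= d -> continuity_2d_pt F 0 t) ->
  (forall t, c <= t <= d -> F 0 t <> 0) ->
  exists r, 0 < r /\ forall u t, Rabs u < r -> c <= t <= d -> F u t <> 0.
Proof.
  intros cd HF F0.
  destruct (continuity_ab_min (fun t => Rabs (F 0 t)) c d cd) as (t0 & Hmin & Ht0).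
  { intros t Ht; apply continuity_pt_comp with (f1 := F 0) (f2 := Rabs); [|apply Rcontinuity_abs].
    apply continuity_pt_filterlim; intros P HP.
    assert (H := HF t Ht); apply continuity_2d_pt_filterlim in H.
    assert (HP' := H P HP). unfold filtermap in *.
    apply (locally_2d_locally (fun x y => P (F x y))) in HP'.
    apply locally_2d_1d_const_x in HP'; exact HP'. }
  assert (m0 : 0 < Rabs (F 0 t0)) by (apply Rabs_pos_lt, F0, Ht0).
  destruct (uniform_continuity_2d_1d' F c d 0 HF (mkposreal _ m0)) as [r Hr]; simpl in Hr.
  exists r; split; [apply cond_pos|]; intros u t Hu Ht Z.
  assert (P := cond_pos r). apply Rabs_def2 in Hu.
  assert (K : Rabs (F u t - F 0 t) < Rabs (F 0 t0)).
  { apply Hr; try lra; rewrite Rminus_diag, Rabs_R0; exact P. }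
  rewrite Z, Rminus_0_l, Rabs_Ropp in K; specialize (Hmin t Ht); lra.
Qed.

Section NormalDeformation.

Variables (a b : Rbar) (x : R -> R * R) (E : frame_data).
Hypothesis x_smooth : smooth_curve a b x.
Hypothesis E_frame : is_affine_frame a b x E.
Hypothesis ell_neq0 : forall t, in_dom a b t -> ell E t <> 0.
Variable psi : R -> R.
Hypothesis psi_smooth : smooth_on a b psi.

Definition normal_deformation (u t : R) : R * R :=
  (fst (x t) + u * (psi t * fst (e2 E t)), snd (x t) + u * (psi t * snd (e2 E t))).

Let x1 u v := fst (normal_deformation u v).
Let x2 u v := snd (normal_deformation u v).

Lemma normal_deformation_0 t : normal_deformation 0 t = x t.
Proof. unfold normal_deformation; rewrite !Rmult_0_l, !Rplus_0_r; destruct (x t); reflexivity. Qed.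

Lemma normal_deformation_smooth delta :
  smooth2 (strip a b delta) x1 /\ smooth2 (strip a b delta) x2.
Proof.
  set (U := strip a b delta). assert (U_open : open2 U) by apply strip_open.
  assert (lift : forall g, smooth_on a b g -> smooth2 U (fun _ v => g v)).
  { intros g; apply smooth2_lift; [exact U_open|]. intros u v H; apply H. }
  assert (Su : smooth2 U (fun u _ => u)) by exact (smooth2_coord U U_open Eta).
  assert (Sp := lift _ psi_smooth).
  destruct x_smooth as [X1 X2]; apply lift in X1, X2.
  destruct E_frame as (_ & (B1 & B2) & _); apply lift in B1, B2.
  split.
  - change (smooth2 U (fun u v => fst (x v) + u * (psi v * fst (e2 E v)))).
    apply (smooth2_plus U U_open (fun _ v => fst (x v))); [exact X1|].
    apply (smooth2_mult U U_open (fun u _ => u)); [exact Su|].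
    apply (smooth2_mult U U_open (fun _ v => psi v)); assumption.
  - change (smooth2 U (fun u v => snd (x v) + u * (psi v * snd (e2 E v)))).
    apply (smooth2_plus U U_open (fun _ v => snd (x v))); [exact X2|].
    apply (smooth2_mult U U_open (fun u _ => u)); [exact Su|].
    apply (smooth2_mult U U_open (fun _ v => psi v)); assumption.
Qed.

Lemma normal_deformation_slice_smooth u : smooth_curve a b (normal_deformation u).
Proof.
  destruct (normal_deformation_smooth (Rabs u + 1)) as [S1 S2].
  split; [apply (smooth_on_slice (strip a b (Rabs u + 1)) a b u x1)
         |apply (smooth_on_slice (strip a b (Rabs u + 1)) a b u x2)];
    trivial; intros t Ht; split; trivial; lra.
Qed.

Lemma frame_normal_deformation_0 : is_affine_frame a b (normal_deformation 0) E.
Proof. apply (frame_restrict a b a b _ x); trivial; intros; apply normal_deformation_0. Qed.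

(** For small [eta] nondegeneracy and absence of inflections both follow from
    [curvature_discriminant <> 0].  Between [c] and [d] this is a compactness argument; on either side the
    curve is still [x], for which the given frame shows it. *)
Lemma normal_deformation_compact c d : in_dom a b c -> in_dom a b d -> c <= d ->
  (forall t, ~ (c < t < d) -> psi t = 0) ->
  exists delta, compact_deformation a b x normal_deformation delta c d.
Proof.
  intros Hc Hd cd Hpsi.
  destruct (normal_deformation_smooth 1) as [S1 S2].
  set (Q := curvature_discriminant x1 x2).
  assert (SQ : smooth2 (strip a b 1) Q)
    by (apply curvature_discriminant_smooth; [apply strip_open|exact S1|exact S2]).
  assert (dom := fun t => in_dom_convex a b c d t Hc Hd).
  assert (Q0 : forall t, in_dom a b t -> Q 0 t <> 0).
  { intros t Ht; exact (frame_discriminant_neq0 a b (normal_deformation 0) E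
      (normal_deformation_slice_smooth 0) frame_normal_deformation_0 ell_neq0 t 0 Ht). }
  destruct (nonvanishing_nearby Q c d cd) as (r & r0 & Hr).
  { intros t Ht; apply (smooth2_cont (strip a b 1)); [exact SQ|].
    split; [rewrite Rabs_R0; lra|auto]. }
  { intros t Ht; apply Q0; auto. }
  assert (outside : forall t u, ~ (c < t < d) -> normal_deformation u t = x t).
  { intros t u Ht; unfold normal_deformation; rewrite (Hpsi t Ht), !Rmult_0_l, !Rmult_0_r, !Rplus_0_r.
    destruct (x t); reflexivity. }
  assert (Qu : forall u t, Rabs u < Rmin r 1 -> in_dom a b t -> Q u t <> 0).
  { intros u t Hu Ht.
    assert (Hu1 := Rlt_le_trans _ _ _ Hu (Rmin_l r 1)).
    (* Used on the two components of (a, b) outside [c, d], where the curve is [x]. *)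
    assert (piece : forall a' b', in_dom a' b' t ->
       (forall v, in_dom a' b' v -> in_dom a b v /\ ~ (c < v < d)) -> Q u t <> 0).
    { intros a' b' Ht' H.
      refine (frame_discriminant_neq0 a' b' (normal_deformation u) E _ _ _ t u Ht').
      - destruct (normal_deformation_slice_smooth u) as [T1 T2].
        split; intros n v Hv; [apply T1|apply T2]; apply H, Hv.
      - apply (frame_restrict a b a' b' _ x); [intros; apply H; assumption| |exact E_frame].
        intros v Hv; apply outside, H, Hv.
      - intros v Hv; apply ell_neq0, H, Hv. }
    destruct (Rlt_or_le t c) as [H|H]; [|destruct (Rlt_or_le d t) as [H'|H']].
    - apply (piece a (Finite c)); [split; [apply Ht|exact H]|].
      intros v [V1 V2]; simpl in V2; split; [|lra].
      split; [exact V1|]. exact (Rbar_lt_trans v c b V2 (proj2 Hc)).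
    - apply (piece (Finite d) b); [split; [exact H'|apply Ht]|].
      intros v [V1 V2]; simpl in V1; split; [|lra].
      split; [|exact V2]. exact (Rbar_lt_trans a d v (proj1 Hd) V1).
    - apply Hr; [exact Hu1|lra]. }
  assert (slice : forall u, Rabs u < Rmin r 1 ->
     nondegenerate a b (normal_deformation u) /\ no_inflection a b (normal_deformation u)).
  { intros u Hu.
    assert (Sm := normal_deformation_slice_smooth u).
    assert (W0 : forall v t, in_dom a b t -> wronskian
       (fun _ t => fst (normal_deformation u t)) (fun _ t => snd (normal_deformation u t)) v t <> 0).
    { intros v t Ht W; apply (Qu u t Hu Ht).
      change (wronskian x1 x2 u t = 0) in W.
      unfold Q, curvature_discriminant; cbv zeta; rewrite W; ring. }
    split; [apply (wronskian_neq0 a b), W0|].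
    intros t Ht (F & HF & l0); apply (Qu u t Hu Ht).
    destruct (frame_invariants a b _ Sm F HF) as (_ & _ & _ & Eq).
    unfold Q; rewrite (curvature_discriminant_eq (strip a b 1)); trivial.
    - specialize (Eq u t Ht); change (scaled_affine_curvature x1 x2 u t = omega F t ^ 2 * ell F t) in Eq.
      rewrite Eq, l0; ring.
    - apply strip_open.
    - split; [|exact Ht]. exact (Rlt_le_trans _ _ _ Hu (Rmin_r r 1)).
    - exact (W0 u t Ht). }
  exists (Rmin r 1).
  split; [apply Rmin_pos; lra|]. split; [exact Hc|]. split; [exact Hd|]. split; [exact cd|].
  split; [|split; [exact slice|split]].
  - intros n u t Hu Ht.
    assert (Ut : strip a b 1 u t)
      by (split; [exact (Rlt_le_trans _ _ _ Hu (Rmin_r r 1))|exact Ht]).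
    split; [exact (S1 n u t Ut)|exact (S2 n u t Ut)].
  - intros t _; apply normal_deformation_0.
  - intros u t _ _ Ht; apply outside; lra.
Qed.

(** Since [n = omega ^ 2 e2] the component along [n] is the one along [e2] divided by omega^2. *)
Lemma normal_deformation_component t : in_dom a b t ->
  normal_component x1 x2 0 t = psi t / omega E t ^ 2.
Proof.
  intro Ht.
  destruct (frame_invariants a b _ (normal_deformation_slice_smooth 0) E frame_normal_deformation_0)
    as (EW & D0 & _).
  specialize (EW 0 t Ht); specialize (D0 0 t Ht).
  assert (r0 := frame_omega_pos a b x E E_frame t Ht).
  change (wronskian x1 x2 0 t = omega E t ^ 3 * (fst (e1 E t) * snd (e2 E t) - snd (e1 E t) * fst (e2 E t))) in EW.
  change (fst (e1 E t) * snd (e2 E t) - snd (e1 E t) * fst (e2 E t) <> 0) in D0.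
  destruct frame_normal_deformation_0 as (_ & _ & _ & _ & H).
  destruct (H t Ht) as (_ & _ & V & _).
  assert (V1 : pd Time x1 0 t = omega E t * fst (e1 E t)) by exact (f_equal fst V).
  assert (V2 : pd Time x2 0 t = omega E t * snd (e1 E t)) by exact (f_equal snd V).
  assert (Y1 : pd Eta x1 0 t = psi t * fst (e2 E t)).
  { apply is_derive_unique; unfold x1, normal_deformation; simpl; auto_derive; [exact I|ring]. }
  assert (Y2 : pd Eta x2 0 t = psi t * snd (e2 E t)).
  { apply is_derive_unique; unfold x2, normal_deformation; simpl; auto_derive; [exact I|ring]. }
  unfold normal_component; rewrite EW, V1, V2, Y1, Y2; field; split; [lra|exact D0].
Qed.

End NormalDeformation.

Theorem theorem3p6 (f : R -> R) (a b : Rbar) (x : R -> R * R)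
  (E : frame_data) (eps : R) (s : R -> R)
  (f_smooth : forall (n : nat) (r : R), ex_derive_n f n r)
  (ab : Rbar_lt a b)
  (x_smooth : smooth_curve a b x)
  (x_nondegenerate : nondegenerate a b x)
  (x_no_inflection : no_inflection a b x)
  (E_frame : is_affine_frame a b x E)
  (eps_sign : forall t, in_dom a b t -> ga_sign E t = eps)
  (s_param : ga_length_parameter a b E s) :
  let k := ga_curvature E in
  let D := deriv_wrt s in
  let G := fun t =>
    4 * Derive_n f 4 (k t) * (D k t) ^ 3
    + 12 * Derive_n f 3 (k t) * D k t * D (D k) t
    + Derive_n f 2 (k t) *
        (4 * D (D (D k)) t - D k t * (k t) ^ 2 + 16 * eps * D k t)
    - Derive_n f 1 (k t) * k t * D k t
    + f (k t) * D k t in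
  ga_extremal a b f x <->
  forall t, in_dom a b t ->
    D (D G) t + 3 / 2 * D G t * k t + 1 / 2 * G t * D k t
    + 1 / 2 * G t * (k t) ^ 2 + eps * G t = 0.
Proof.
  intros k D G.
  set (L := fun t => D (D G) t + 3 / 2 * D G t * k t + 1 / 2 * G t * D k t
    + 1 / 2 * G t * (k t) ^ 2 + eps * G t).
  assert (l0 := frame_ell_neq0 a b x E x_no_inflection E_frame).
  (* Where a family of curves passes through [x], its invariants are those of the frame [E]. *)
  assert (slice : forall X : R -> R -> R * R, forall u, smooth_curve a b (X u) ->
     (forall t, in_dom a b t -> X u t = x t) ->
     forall t, in_dom a b t ->
     let x1 := fun u v => fst (X u v) in let x2 := fun u v => snd (X u v) in
     curve_sign x1 x2 u t = eps /\
     length_density x1 x2 u t = ga_length_element E t /\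
     euler_lagrange f (curve_sign x1 x2) (length_density x1 x2) (curvature x1 x2) u t = L t).
  { intros X u SX HX t Ht x1 x2.
    assert (HE := frame_restrict a b a b (X u) x E ltac:(auto) HX E_frame).
    assert (He : forall v, in_dom a b v -> curve_sign x1 x2 u v = eps).
    { intros v Hv; rewrite <- (eps_sign v Hv).
      exact (frame_sign a b (X u) SX E HE u v Hv (l0 v Hv)). }
    assert (Hsg : forall v, in_dom a b v -> length_density x1 x2 u v = ga_length_element E v)
      by exact (frame_length a b (X u) SX E HE u).
    refine (conj (He t Ht) (conj (Hsg t Ht) _)).
    refine (euler_lagrange_slice a b f s _ _ _ u eps k _ He _ t Ht).
    - intros v Hv; rewrite (Hsg v Hv); symmetry; apply is_derive_unique, s_param, Hv.
    - intros v Hv; exact (frame_curvature a b (X u) SX E HE u v Hv (l0 v Hv)). }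
  split.
  - intros ext t0 Ht0; change (L t0 = 0); destruct (Req_dec (L t0) 0) as [Z|L0]; [exact Z|exfalso].
    set (U := fun _ v : R => in_dom a b v).
    assert (U_open : open2 U) by apply cylinder_open.
    set (y1 := fun _ v : R => fst (x v)). set (y2 := fun _ v : R => snd (x v)).
    assert (Sy1 : smooth2 U y1) by exact (cylinder_smooth a b _ (proj1 x_smooth)).
    assert (Sy2 : smooth2 U y2) by exact (cylinder_smooth a b _ (proj2 x_smooth)).
    assert (W0 := proj1 (wronskian_neq0 a b x) x_nondegenerate).
    assert (q0 : forall u v, U u v -> scaled_affine_curvature y1 y2 u v <> 0).
    { intros u v Huv; destruct (frame_invariants a b x x_smooth E E_frame) as (_ & _ & _ & Eq).
      unfold y1, y2; rewrite (Eq u v Huv); apply Rmult_integral_contrapositive; split; [|exact (l0 v Huv)].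
      apply pow_nonzero, Rgt_not_eq, (frame_omega_pos a b x E E_frame v Huv). }
    (* The constant family at [x] shows that the Euler-Lagrange expression is smooth. *)
    set (EL := euler_lagrange f (curve_sign y1 y2) (length_density y1 y2) (curvature y1 y2)).
    assert (SEL : smooth2 U EL).
    { apply (euler_lagrange_smooth U U_open f f_smooth).
      - intros u v Huv; apply (length_density_neq0 U); assumption.
      - apply curve_sign_smooth; assumption.
      - apply length_density_smooth; assumption.
      - apply curvature_smooth; assumption. }
    assert (HEL : forall t, in_dom a b t -> EL 0 t = L t).
    { intros t Ht; exact (proj2 (proj2 (slice (fun _ => x) 0 x_smooth (fun _ _ => eq_refl) t Ht))). }
    assert (ELs : smooth_on a b (EL 0)) by (apply (smooth_on_slice U); auto).
    assert (near : locally t0 (fun t => EL 0 t <> 0 /\ in_dom a b t)).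
    { apply filter_and; [|apply in_dom_open, Ht0].
      apply (locally_2d_1d_const_x (fun u t => EL u t <> 0) 0 t0), continuity_2d_pt_neq_0.
      - apply (smooth2_cont U); assumption.
      - rewrite (HEL t0 Ht0); exact L0. }
    destruct near as [r Hr]; assert (r0 := cond_pos r).
    set (c := t0 - r / 2). set (d := t0 + r / 2).
    assert (cd : c < d) by (unfold c, d; lra).
    assert (Hcd : forall t, c <= t <= d -> EL 0 t <> 0 /\ in_dom a b t).
    { intros t Ht; apply Hr. unfold ball; simpl; unfold AbsRing_ball, abs, minus, plus, opp; simpl.
      apply Rabs_def1; unfold c, d in Ht; lra. }
    destruct (bump_exists a b c d) as (phi & Sphi & phi_pos & phi_zero).
    (* The factor [EL] makes the integrand of the first variation a square times [phi], and [eps]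
       cancels the sign of the curve. *)
    set (psi := fun t => eps * (phi t * EL 0 t)).
    assert (Spsi : smooth_on a b psi).
    { apply (smooth_on_slice U a b 0 (fun _ t => eps * (phi t * EL 0 t))); [auto|].
      apply (smooth2_mult U U_open (fun _ _ => eps)); [apply smooth2_const, U_open|].
      apply (smooth2_mult U U_open (fun _ t => phi t)); [exact (cylinder_smooth a b _ Sphi)|].
      exact (cylinder_smooth a b _ ELs). }
    set (X := normal_deformation x E psi).
    destruct (normal_deformation_compact a b x E x_smooth E_frame l0 psi Spsi c d) as [delta HX].
    { apply (Hcd c); lra. }
    { apply (Hcd d); lra. }
    { lra. }
    { intros t Ht; unfold psi; rewrite (phi_zero t Ht); ring. }
    assert (HF : forall eta, Rabs eta < delta -> is_affine_frame a b (X eta) (canonical_frame (X eta))).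
    { intros eta Heta; apply canonical_frame_is_frame.
      - apply (normal_deformation_slice_smooth a b x E x_smooth E_frame psi Spsi).
      - apply HX, Heta. }
    assert (D1 := ext X delta c d _ HX HF).
    assert (D2 := first_variation a b x X delta c d HX f f_smooth _ HF).
    apply is_derive_unique in D1; apply is_derive_unique in D2; rewrite D1 in D2; clear D1.
    match type of D2 with _ = _ * RInt ?h c d => set (H := h) in D2 end.
    assert (pos : 0 < RInt H c d); [|lra].
    assert (Xs := slice X 0
      (normal_deformation_slice_smooth a b x E x_smooth E_frame psi Spsi 0)
      (fun t _ => normal_deformation_0 x E psi t)).
    cbv zeta in Xs.
    assert (EH : forall t, in_dom a b t -> H t = eps * ga_length_element E t ^ 3
       * (psi t / omega E t ^ 2) * L t).
    { intros t Ht; destruct (Xs t Ht) as (E1 & E2 & E3); unfold H; rewrite E1, E2, E3.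
      f_equal; f_equal.
      exact (normal_deformation_component a b x E x_smooth E_frame psi Spsi t Ht). }
    apply RInt_gt_0; [exact cd| |].
    + intros t Ht; destruct (Hcd t) as [EL0 Hdom]; [lra|].
      rewrite (EH t Hdom); unfold psi.
      rewrite (HEL t Hdom) in EL0 |- *.
      assert (sg0 := length_density_pos U y1 y2 q0 0 t Hdom).
      destruct (slice (fun _ => x) 0 x_smooth (fun _ _ => eq_refl) t Hdom) as (E1 & E2 & _).
      change (length_density y1 y2 0 t = ga_length_element E t) in E2; rewrite E2 in sg0.
      assert (e2 := curve_sign_square U y1 y2 q0 0 t Hdom).
      change (curve_sign y1 y2 0 t = eps) in E1; rewrite E1 in e2.
      assert (o0 := frame_omega_pos a b x E E_frame t Hdom).
      replace (eps * ga_length_element E t ^ 3 * (eps * (phi t * L t) / omega E t ^ 2) * L t)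
        with ((eps * eps) * (ga_length_element E t ^ 3 * (phi t / omega E t ^ 2) * L t ^ 2))
        by (field; lra).
      rewrite e2, Rmult_1_l.
      apply Rmult_lt_0_compat; [|apply pow2_gt_0, EL0].
      apply Rmult_lt_0_compat; [apply pow_lt, sg0|].
      apply Rdiv_lt_0_compat; [apply phi_pos, Ht|apply pow_lt, o0].
    + assert (V_open := strip_open a b delta). set (V := strip a b delta) in V_open.
      destruct (deformation_smooth a b x X delta c d HX) as [S1 S2].
      assert (XW := deformation_wronskian_neq0 a b x X delta c d HX).
      assert (Xq := deformation_curvature_neq0 a b x X delta c d HX _ HF).
      set (x1 := fun u v => fst (X u v)) in *. set (x2 := fun u v => snd (X u v)) in *.
      fold V in S1, S2, XW, Xq.
      assert (Ssg : smooth2 V (length_density x1 x2)) by (apply length_density_smooth; assumption).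
      assert (Se : smooth2 V (curve_sign x1 x2)) by (apply curve_sign_smooth; assumption).
      assert (Sk : smooth2 V (curvature x1 x2)) by (apply curvature_smooth; assumption).
      assert (Snu : smooth2 V (normal_component x1 x2))
        by (apply normal_component_smooth; assumption).
      assert (SEL' : smooth2 V (euler_lagrange f (curve_sign x1 x2) (length_density x1 x2)
                           (curvature x1 x2))).
      { apply (euler_lagrange_smooth V V_open f f_smooth); try assumption.
        intros u v Huv; apply (length_density_neq0 V); assumption. }
      set (SH := fun u t => curve_sign x1 x2 u t
        * (length_density x1 x2 u t * (length_density x1 x2 u t * length_density x1 x2 u t))
        * normal_component x1 x2 u t
        * euler_lagrange f (curve_sign x1 x2) (length_density x1 x2) (curvature x1 x2) u t).
      assert (S : smooth2 V SH) by (unfold SH; smooth_auto).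
      intros t Ht; apply (continuous_ext (SH 0)).
      * intro v; change (SH 0 v = H v :> R); unfold SH, H; fold x1 x2; ring.
      * apply (smooth2_slice_continuous a b delta); [exact S|].
        split; [rewrite Rabs_R0; apply HX|apply Hcd, Ht].
  - intros EL X delta c d F HX HF.
    assert (D1 := first_variation a b x X delta c d HX f f_smooth F HF).
    match type of D1 with is_derive _ _ (_ * RInt ?h c d) => replace (RInt h c d) with 0 in D1 end.
    { rewrite Rmult_0_r in D1; exact D1. }
    destruct HX as (d0 & Hc & Hd & cd & HX).
    symmetry; rewrite (RInt_ext _ (fun _ => 0)).
    { rewrite RInt_const; apply Rmult_0_r. }
    intros t Ht; rewrite Rmin_left, Rmax_right in Ht by exact cd.
    assert (Hdom : in_dom a b t) by (apply (in_dom_convex a b c d); trivial; lra).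
    assert (SX : smooth_curve a b (X 0)).
    { apply (deformation_slice_smooth a b x X delta c d); [|rewrite Rabs_R0; exact d0].
      exact (conj d0 (conj Hc (conj Hd (conj cd HX)))). }
    destruct (slice X 0 SX (proj1 (proj2 (proj2 HX))) t Hdom) as (_ & _ & E3).
    rewrite E3; unfold L; rewrite (EL t Hdom); apply Rmult_0_r.
Qed.
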